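(* Let $a,b$ be relatively prime positive integers with $b\geq a+2$, and assume $b=ka+r$ with $k,r$ integers and $1\leq r\leq a-2$. Then the Weierstrass semigroup $\langle a;b\rangle$ (which has genus $g=(a-1)(b-1)/2$) occurs at most once; that is, there is no smooth curve $C$ of genus $(a-1)(b-1)/2$ having two different points $P\neq Q$ with $\mathrm{WS}(P)=\mathrm{WS}(Q)=\langle a;b\rangle$.
   Context: Curves are smooth, irreducible, projective, over $\mathbb{C}$. $\langle a;b\rangle$ denotes the subsemigroup of $\mathbb{N}=\{0,1,2,\dots\}$ generated by $a$ and $b$. A subsemigroup $H\subseteq\mathbb{N}$ is called a Weierstrass semigroup of genus $g$ if $\mathbb{N}\setminus H$ has exactly $g$ elements. For a point $P$ on a smooth curve $C$, $\mathrm{WS}(P)=\{0\}\cup\{m\in\mathbb{N}: |mP| \text{ is a base point free linear system}\}$ (equivalently, the set of pole orders at $P$ of rational functions regular on $C\setminus\{P\}$); it is a Weierstrass semigroup whose genus is the genus of $C$. A Weierstrass semigroup $H$ of genus $g$ occurs at most once if there is no curve of genus $g$ with two different points $P\neq Q$ satisfying $\mathrm{WS}(P)=\mathrm{WS}(Q)=H$. *)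

(* Defs.v *)
From HB Require Import structures.
From mathcomp Require Import all_boot all_order all_algebra.
From mathcomp Require Import generic_quotient ring_quotient fraction.
From mathcomp Require Import mathcomp_extra boolp classical_sets functions.
From mathcomp Require Import cardinality reals.
From mathcomp Require Import complex freeg mpoly.

Set Implicit Arguments.
Unset Strict Implicit.
Unset Printing Implicit Defensive.

Import Order.TTheory GRing.Theory Num.Theory.

Local Open Scope classical_set_scope.
Local Open Scope ring_scope.
Local Open Scope quotient_scope.

Section ProjectiveSpace.

Variables (K : closedFieldType) (n : nat).

Definition pspace := {L : {vspace 'rV[K]_n.+1} | \dim L == 1%N}.

(* F need not be homogeneous: it has to vanish at every choice of homogeneous
   coordinates of P. *)
Definition zero_at (P : pspace) (F : {mpoly K[n.+1]}) : Prop :=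
  forall v, v \in val P -> v != 0 -> F.@[v ord0] = 0.

Definition zero_locus (S : set {mpoly K[n.+1]}) : set pspace :=
  [set P | forall F, S F -> zero_at P F].

Definition zariski_closed (Z : set pspace) : Prop :=
  exists S, Z = zero_locus S.

Definition zariski_irreducible (Z : set pspace) : Prop :=
  Z !=set0 /\
  forall Y1 Y2, zariski_closed Y1 -> zariski_closed Y2 ->
    Z `<=` Y1 `|` Y2 -> Z `<=` Y1 \/ Z `<=` Y2.

Record projective_variety := ProjectiveVariety {
  pts : set pspace;
  pts_closed : zariski_closed pts;
  pts_irreducible : zariski_irreducible pts }.

Definition line_poly (v : 'rV[K]_n.+1) (F : {mpoly K[n.+1]}) : {poly K} :=
  mmap polyC (fun i => v ord0 i *: 'X) F.

Lemma horner_line_poly v F c : (line_poly v F).[c] = F.@[(c *: v) ord0].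
Proof.
rewrite /line_poly /mmap mevalE horner_sum; apply: eq_bigr => m _.
rewrite hornerCM; congr (_ * _); rewrite /mmap1 horner_prod.
apply: eq_bigr => i _; rewrite horner_exp hornerZ hornerX.
by rewrite mxE mulrC.
Qed.

Lemma zero_atM P F G : zero_at P (F * G) -> zero_at P F \/ zero_at P G.
Proof.
case: P => L dimL FG0; pose v := vpick L.
have vN0 : v != 0 by rewrite vpick0 -dimv_eq0 (eqP dimL).
have defL : L = <[v]>%VS.
  apply/esym/eqP; rewrite eqEdim (eqP dimL) dim_vline vN0.
  by rewrite -memvE memv_pick.
have lineP H : line_poly v H * 'X = 0 -> zero_at (exist _ L dimL) H.
  move=> /eqP; rewrite mulf_eq0 polyX_eq0 orbF => /eqP H0 w /=.
  by rewrite defL => /vlineP[c ->] _; rewrite -horner_line_poly H0 horner0.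
have: line_poly v F * 'X * (line_poly v G * 'X) = 0.
  apply/eqP/negPn/(PreClosedField.closed_nonrootP (@solve_monicpoly K)).
  case=> c; rewrite rootE !hornerM hornerX !horner_line_poly.
  have [->|cN0] := eqVneq c 0; first by rewrite !mulr0 eqxx.
  rewrite mulrACA -mevalM FG0 ?mul0r ?eqxx //=.
    by rewrite memvZ ?memv_pick.
  by rewrite scaler_eq0 negb_or cN0.
by move=> /eqP; rewrite mulf_eq0 => /orP[] /eqP /lineP; [left|right].
Qed.

End ProjectiveSpace.

Lemma fracB (L : fieldType) (a b c d : L) : b != 0 -> d != 0 ->
  a / b - c / d = (a * d - c * b) / (b * d).
Proof. by move=> b0 d0; rewrite -mulNr addf_div // mulNr. Qed.

Section SubField.

Variables (L : fieldType) (S : divringClosed L).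

Record subfield := SubField { subfield_val : L; _ : subfield_val \in S }.

HB.instance Definition _ := [isSub for subfield_val].
HB.instance Definition _ := [Choice of subfield by <:].
HB.instance Definition _ := [SubChoice_isSubUnitRing of subfield by <:].
HB.instance Definition _ := [SubNzRing_isSubComNzRing of subfield by <:].
HB.instance Definition _ :=
  [SubComUnitRing_isSubIntegralDomain of subfield by <:].
HB.instance Definition _ := [SubIntegralDomain_isSubField of subfield by <:].

End SubField.

Section Ratio.

Variables (A : comNzRingType) (R : idomainType) (f : {rmorphism A -> R}).

Definition ratio_of (a b : A) : {fraction R} := tofrac (f a) / tofrac (f b).

Lemma ratio_ofB a b c d : f b != 0 -> f d != 0 ->
  ratio_of a b - ratio_of c d = ratio_of (a * d - c * b) (b * d).
Proof.
move=> b0 d0; rewrite /ratio_of !(rmorphB, rmorphM).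
by apply: fracB; rewrite tofrac_eq0.
Qed.

Lemma ratio_ofM a b c d :
  ratio_of a b * ratio_of c d = ratio_of (a * c) (b * d).
Proof. by rewrite /ratio_of mulf_div !rmorphM. Qed.

Lemma ratio_ofV a b : (ratio_of a b)^-1 = ratio_of b a.
Proof. by rewrite /ratio_of invf_div. Qed.

Lemma ratio_of0 b : ratio_of 0 b = 0.
Proof. by rewrite /ratio_of !rmorph0 mul0r. Qed.

Lemma ratio_of_den0 a b : f b = 0 -> ratio_of a b = 0.
Proof. by move=> b0; rewrite /ratio_of b0 rmorph0 invr0 mulr0. Qed.

Lemma ratio_of1 : ratio_of 1 1 = 1.
Proof. by rewrite /ratio_of !rmorph1 divr1. Qed.

End Ratio.

Section FunctionField.

Variables (K : closedFieldType) (n : nat) (X : projective_variety K n).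

Definition ideal_of : pred {mpoly K[n.+1]} :=
  fun F => `[< forall P, pts X P -> zero_at P F >].

Lemma ideal_ofP F :
  reflect (forall P, pts X P -> zero_at P F) (F \in ideal_of).
Proof. exact: asboolP. Qed.

Lemma ideal_of_closed : idealr_closed ideal_of.
Proof.
split.
- by apply/ideal_ofP => P _ v _ _; rewrite meval0.
- apply/negP => /ideal_ofP I1; have [[P XP] _] := pts_irreducible X.
  have /= := I1 P XP (vpick (val P)) (memv_pick _).
  rewrite vpick0 -dimv_eq0 (eqP (valP P)) meval1 => /(_ isT) /eqP.
  by rewrite oner_eq0.
- move=> a F G /ideal_ofP IF /ideal_ofP IG; apply/ideal_ofP => P XP v vP vN0.
  by rewrite mevalD mevalM (IF P) // (IG P) // mulr0 addr0.
Qed.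

HB.instance Definition _ :=
  isIdealr.Build {mpoly K[n.+1]} ideal_of ideal_of_closed.

Lemma ideal_of_prime : prime_idealr_closed ideal_of.
Proof.
move=> F G /ideal_ofP IFG.
pose Z H := zero_locus (K := K) (n := n) [set H].
have closedZ H : zariski_closed (Z H) by exists [set H].
have [_ irrX] := pts_irreducible X.
have subZ : pts X `<=` Z F `|` Z G.
  by move=> P /IFG /zero_atM[?|?]; [left|right] => H ->.
by apply/orP; case: (irrX _ _ (closedZ F) (closedZ G) subZ) => sub;
  [left|right]; apply/ideal_ofP => P /sub; apply.
Qed.

HB.instance Definition _ :=
  isPrimeIdealrClosed.Build {mpoly K[n.+1]} ideal_of ideal_of_prime.

Definition coord_ring := {ideal_quot [the idealr {mpoly K[n.+1]} of ideal_of]}.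

HB.instance Definition _ := GRing.ComNzRing.on coord_ring.

Definition coord_unit : {pred coord_ring} := fun x => `[< exists y, y * x = 1 >].

Definition coord_inv (x : coord_ring) : coord_ring :=
  xget x [set y | y * x = 1].

Lemma coord_mulVx : {in coord_unit, left_inverse 1 coord_inv *%R}.
Proof.
by move=> x /asboolP[y yx]; rewrite /coord_inv; case: xgetP => [z -> //|/(_ y)].
Qed.

Lemma coord_unitPl x y : y * x = 1 -> coord_unit x.
Proof. by move=> yx; apply/asboolP; exists y. Qed.

Lemma coord_inv_out : {in [predC coord_unit], coord_inv =1 id}.
Proof.
move=> x /asboolPn xNunit; rewrite /coord_inv; case: xgetP => // y _ yx.
by case: xNunit; exists y.
Qed.

HB.instance Definition _ := GRing.ComNzRing_hasMulInverse.Build coord_ring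
  coord_mulVx coord_unitPl coord_inv_out.

Lemma coord_integral (x y : coord_ring) : x * y = 0 -> (x == 0) || (y == 0).
Proof. exact: Quotient.rquot_IdomainAxiom. Qed.

HB.instance Definition _ :=
  GRing.ComUnitRing_isIntegral.Build coord_ring coord_integral.

Definition to_coord (F : {mpoly K[n.+1]}) : coord_ring := \pi_coord_ring F.

Lemma to_coord_is_zmod_morphism : zmod_morphism to_coord.
Proof. by move=> F G; rewrite /to_coord -pi_is_zmod_morphism. Qed.

HB.instance Definition _ :=
  GRing.isZmodMorphism.Build {mpoly K[n.+1]} coord_ring to_coord
    to_coord_is_zmod_morphism.

Lemma to_coord_is_monoid_morphism : monoid_morphism to_coord.
Proof. exact: pi_is_monoid_morphism. Qed.

HB.instance Definition _ :=
  GRing.isMonoidMorphism.Build {mpoly K[n.+1]} coord_ring to_coord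
    to_coord_is_monoid_morphism.

Lemma to_coord_eq0 F : (to_coord F == 0) = (F \in ideal_of).
Proof.
rewrite -[0](rmorph0 to_coord) -[F in RHS]subr0.
exact/esym/Quotient.idealrBE.
Qed.

Definition form_ratio : {mpoly K[n.+1]} -> {mpoly K[n.+1]} ->
  {fraction coord_ring} := ratio_of to_coord.

Definition is_ratfun (x : {fraction coord_ring}) : bool :=
  `[< exists d F G, [/\ F \is d.-homog, G \is d.-homog,
        G \notin ideal_of & x = form_ratio F G] >].

Lemma is_ratfunP x :
  reflect (exists d F G, [/\ F \is d.-homog, G \is d.-homog,
             G \notin ideal_of & x = form_ratio F G]) (x \in is_ratfun).
Proof. exact: asboolP. Qed.

Lemma ideal_ofM F G : F \notin ideal_of -> G \notin ideal_of ->
  F * G \notin ideal_of.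
Proof.
by move=> FN GN; apply/negP => /ideal_of_prime; rewrite (negPf FN) (negPf GN).
Qed.

Lemma is_ratfun_divring_closed : divring_closed is_ratfun.
Proof.
split.
- apply/is_ratfunP; exists 0%N, 1, 1; split; rewrite ?dhomog1 ?idealr1 //.
  exact/esym/ratio_of1.
- move=> x y /is_ratfunP[d [F [G [hF hG GN ->]]]].
  move=> /is_ratfunP[e [F' [G' [hF' hG' GN' ->]]]].
  apply/is_ratfunP; exists (d + e)%N, (F * G' - F' * G), (G * G'); split.
  + by apply: rpredB; [|rewrite addnC]; exact: dhomogM.
  + exact: dhomogM.
  + exact: ideal_ofM.
  + by apply: ratio_ofB; rewrite to_coord_eq0.
- move=> x y /is_ratfunP[d [F [G [hF hG GN ->]]]].
  move=> /is_ratfunP[e [F' [G' [hF' hG' GN' ->]]]].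
  rewrite /form_ratio ratio_ofV ratio_ofM.
  have [F'I|F'N] := boolP (F' \in ideal_of); apply/is_ratfunP; last first.
    exists (d + e)%N, (F * G'), (G * F').
    by split; [exact: dhomogM | exact: dhomogM | exact: ideal_ofM |].
  exists 0%N, 0, 1; split; rewrite ?dhomog1 ?dhomog0 ?idealr1 //.
  rewrite /form_ratio ratio_of0; apply: ratio_of_den0; apply/eqP.
  by rewrite to_coord_eq0 idealMr.
Qed.

HB.instance Definition _ :=
  GRing.isDivringClosed.Build {fraction coord_ring} is_ratfun
    is_ratfun_divring_closed.

(* Quotients of two forms of the same degree, inside the fraction field of the
   homogeneous coordinate ring. *)
Definition function_field :=
  subfield (GRing.DivringClosed.clone {fraction coord_ring} is_ratfun _).

HB.instance Definition _ := GRing.Field.on function_field.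

End FunctionField.

Section SmoothCurve.

Variables (K : closedFieldType) (n : nat) (X : projective_variety K n).

Local Notation "'K(X)'" := (function_field X) (at level 0).

Lemma const_is_ratfun (c : K) : form_ratio X c%:MP 1 \in is_ratfun (X := X).
Proof.
apply/is_ratfunP; exists 0%N, c%:MP, 1; split; rewrite ?dhomog1 ?idealr1 //.
by rewrite -[c%:MP]mulr1 mul_mpolyC; apply/dhomogZ/dhomog1.
Qed.

Definition const (c : K) : K(X) := SubField (const_is_ratfun c).

Definition point := {P : pspace K n | P \in pts X}.

Definition alg_independent (m : nat) (f : 'I_m -> K(X)) : Prop :=
  forall p : {mpoly K[m]}, mmap const f p = 0 -> p = 0.

(* The dimension of X is the transcendence degree of K(X) over K. *)
Definition has_dimension (d : nat) : Prop :=
  (exists f : 'I_d -> K(X), alg_independent f) /\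
  ~ (exists f : 'I_d.+1 -> K(X), alg_independent f).

Definition local_ring (P : point) : set K(X) :=
  [set f | exists d F G, [/\ F \is d.-homog, G \is d.-homog,
     ~ zero_at (val P) G & val f = form_ratio X F G]].

Definition local_unit (P : point) (u : K(X)) : Prop :=
  [/\ u != 0, local_ring P u & local_ring P u^-1].

Definition uniformizer (P : point) (t : K(X)) : Prop :=
  [/\ t != 0, local_ring P t, ~ local_unit P t &
     forall f, local_ring P f -> f != 0 ->
       exists (m : nat) (u : K(X)), local_unit P u /\ f = u * t ^+ m].

(* In dimension 1, X is smooth at P iff the local ring at P is regular, that is,
   a discrete valuation ring. *)
Definition smooth_at (P : point) : Prop := exists t, uniformizer P t.

Definition smooth_projective_curve : Prop :=
  has_dimension 1 /\ forall P : point, smooth_at P.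

(* Meaningful when X is smooth at P and f != 0. *)
Definition ord (P : point) (f : K(X)) : int :=
  xget 0 [set m | exists t u,
    [/\ uniformizer P t, local_unit P u & f = u * t ^ m]].

Definition divisor := {freeg point / int}.

Definition effective (D : divisor) : Prop := forall P, 0 <= coeff P D.

Definition lin_equiv (D E : divisor) : Prop :=
  exists2 f : K(X), f != 0 & forall P, ord P f = coeff P D - coeff P E.

Definition complete_linear_system (D : divisor) : set divisor :=
  [set E | effective E /\ lin_equiv E D].

Definition base_point_free (L : set divisor) : Prop :=
  forall P, exists2 E, L E & coeff P E = 0.

Definition weierstrass_set (P : point) : set nat :=
  [set 0%N] `|`
  [set m | base_point_free (complete_linear_system << m%:Z *g P >>)].

Definition riemann_roch_space (D : divisor) : set K(X) :=
  [set f | f = 0 \/ forall P, - coeff P D <= ord P f].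

Definition lin_independent (m : nat) (f : 'I_m -> K(X)) : Prop :=
  forall c : 'I_m -> K, \sum_i const (c i) * f i = 0 -> forall i, c i = 0.

(* l(D) >= deg D + 1 - g for every divisor D. *)
Definition riemann_inequality (g : nat) : Prop :=
  forall D : divisor, exists m (f : 'I_m -> K(X)),
    [/\ forall i, riemann_roch_space D (f i), lin_independent f &
        deg D + 1 - g%:Z <= m%:Z].

(* The genus is the least g satisfying Riemann's inequality. *)
Definition has_genus (g : nat) : Prop :=
  riemann_inequality g /\ forall g', riemann_inequality g' -> (g <= g')%N.

End SmoothCurve.

Definition subsemigroup (H : set nat) : Prop :=
  H 0%N /\ forall x y, H x -> H y -> H (x + y)%N.

Definition generated_semigroup (a b : nat) : set nat :=
  smallest subsemigroup [set a; b].

Definition weierstrass_semigroup (H : set nat) (g : nat) : Prop :=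
  subsemigroup H /\ (~` H #= `I_g)%card.

(* To be used when H is a Weierstrass semigroup of genus g. *)
Definition occurs_at_most_once (K : closedFieldType) (H : set nat)
  (g : nat) : Prop :=
  ~ exists (n : nat) (C : projective_variety K n) (P Q : point C),
      [/\ smooth_projective_curve C, has_genus C g, P != Q,
          weierstrass_set P = H & weierstrass_set Q = H].

(* Main.v *)
From HB Require Import structures.
From mathcomp Require Import all_boot all_order all_algebra.
From mathcomp Require Import ring_quotient fraction boolp classical_sets.
From mathcomp Require Import cardinality reals complex freeg mpoly.
From mathcomp Require Import zify ring.
Require Import Defs.

(* Let A be the ring of functions on C regular outside P, and let x, y in A have
   poles of order a and b at P and vanish at Q.  Every f in A is phi(y) + x F
   with F in A and b deg(phi) at most the pole order of f, because the pole
   orders of the x^i y^j exhaust those of A.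

   1. x or y is a local parameter at Q.  The relation y^a = ... read modulo x
      gives w = f(y)/x outside A with m w contained in A, m being the ideal of Q.
      As A is integrally closed, m w is not contained in m, so all orders at Q
      of functions in A, hence of all functions, are multiples of -ord_Q(w).
   2. Let u have polar divisor aQ.  A function h in A of pole order at most 2g - 2
      at P cannot have order a - 1 at Q: h u would have a simple pole at Q and
      pole order at most 2g - 2 at P, which the expansion rules out by degree
      in y.  (This replaces the duality part of Riemann-Roch.)
   3. If ord_Q(x) = e < a, then h = x^(a-1) (e = 1) or h = x y^(a-1-e) (e > 1)
      contradicts 2; here b >= a + 2 is used.  Hence ord_Q(x) >= a, and then
      x (u - u(P)) is a constant, so ord_Q(x) = a.
   4. Let v have polar divisor bQ and b = k a + r.  Then v x^(k+1) lies in A, has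
      pole order at most (k+1)a < 2b at P, and so is c + c' y + x F; its order
      a - r at Q is then 0, 1 or at least a, against 1 <= r <= a - 2. *)

Set Implicit Arguments.
Unset Strict Implicit.
Unset Printing Implicit Defensive.

Import Order.TTheory GRing.Theory Num.Theory.

Local Open Scope classical_set_scope.
Local Open Scope ring_scope.

(** * Numerical semigroups *)

Section NumericalSemigroup.

Variables a b : nat.

(** Bounding [j] by [a] loses nothing, since [b * a] can be moved to the multiples of [a]; this
    makes membership decidable, so that gaps can be counted. *)
Definition in_sgp (n : nat) : bool :=
  [exists j : 'I_a, (b * j <= n)%N && (a %| n - b * j)%N].

Hypotheses (a_gt0 : (0 < a)%N) (b_gt0 : (0 < b)%N) (co_ab : coprime a b).

Lemma in_sgpP n :
  reflect (exists i j, n = (a * i + b * j)%N) (in_sgp n).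
Proof.
apply: (iffP existsP) => [[j /andP[le_j /dvdnP[i ni]]]|[i [j ->]]].
  by exists i, j; rewrite mulnC -ni subnK.
exists (Ordinal (ltn_pmod j a_gt0)) => /=.
have ->: (a * i + b * j = a * (i + b * (j %/ a)) + b * (j %% a))%N.
  by rewrite {1}(divn_eq j a); ring.
by rewrite leq_addl addnK dvdn_mulr.
Qed.

Lemma sgp_residue n : exists2 j, (j < a)%N & (b * j = n %[mod a])%N.
Proof.
case: (@egcdnP b a b_gt0) => u v uv _.
have {}uv : (u * b = v * a + 1)%N by rewrite uv gcdnC (eqP co_ab).
exists ((u * n) %% a)%N; first by rewrite ltn_mod.
rewrite modnMmr.
have ->: (b * (u * n) = v * n * a + n)%N.
  by transitivity ((u * b) * n)%N; [ring|rewrite uv; ring].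
by rewrite modnMDl.
Qed.

(** A representation [a * i + b * j] would force [j < m] and, by coprimality, [a %| m - j], although
    [0 < m - j < a]. *)
Lemma sgp_gap m : (0 < m < a)%N -> (a <= b * m)%N -> ~~ in_sgp (b * m - a).
Proof.
move=> /andP[m0 ma] le_a; apply/in_sgpP => -[i [j e]].
have e' : (b * m = a * i.+1 + b * j)%N by lia.
have jm : (j < m)%N.
  rewrite ltnNge; apply/negP => mj.
  have : (b * m <= b * j)%N by rewrite leq_mul2l mj orbT.
  nia.
have : (a %| b * (m - j))%N.
  by rewrite mulnBr e' addnK dvdn_mulr.
by rewrite Gauss_dvdr // => /dvdn_leq; lia.
Qed.

(** Symmetry about the Frobenius number [a * b - a - b]. That number is a gap, so [n] and [n'] are
    not both members. If [n] is a gap, the representative [b * j] of its class modulo [a] is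
    [n + a * s.+1], whence [n' = a * s + b * (a - 1 - j)]. *)
Lemma sgp_sym n n' : (n + n' + a + b = a * b)%N -> in_sgp n = ~~ in_sgp n'.
Proof.
move=> e; apply/idP/idP => [/in_sgpP[i [j hn]]|hn'].
  apply/negP => /in_sgpP[i' [j' hn']].
  have := @sgp_gap (a - 1).
  have -> : (b * (a - 1) - a = a * (i + i') + b * (j + j'))%N.
    by rewrite mulnBr muln1 !mulnDr; lia.
  have a1 : (1 < a)%N by nia.
  have lt : (0 < a - 1 < a)%N by lia.
  move=> /(_ lt); have -> : (a <= b * (a - 1))%N by nia.
  by move=> /(_ isT) /negP; apply; apply/in_sgpP; exists (i + i')%N, (j + j')%N.
have [j ja /eqP] := sgp_residue n.
have [le_j|lt_n] := leqP (b * j) n.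
  rewrite eq_sym eqn_mod_dvd // => d; apply/existsP.
  by exists (Ordinal ja); rewrite le_j.
rewrite eqn_mod_dvd ?(ltnW lt_n) // => /dvdnP[[|s] es]; first lia.
case/negP: hn'; apply/in_sgpP; exists s, (a - 1 - j)%N.
have ea : a = (j + 1 + (a - 1 - j))%N by lia.
have {}es : (b * j = n + a * s.+1)%N by lia.
have : (a * b = b * j + b + b * (a - 1 - j))%N by rewrite {1}ea; ring.
by rewrite es mulnS; lia.
Qed.

Lemma sgp_large n : ((a - 1) * (b - 1) <= n)%N -> in_sgp n.
Proof.
move=> le_n; have [j ja /eqP] := sgp_residue n.
have [le_j|lt_j] := leqP (b * j) n.
  rewrite eq_sym eqn_mod_dvd // => d; apply/existsP.
  by exists (Ordinal ja); rewrite le_j.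
rewrite eqn_mod_dvd ?(ltnW lt_j) // => /dvdnP[[|s] es]; first lia.
by exfalso; nia.
Qed.

Lemma generated_semigroupE : generated_semigroup a b = [set n | in_sgp n].
Proof.
apply/seteqP; split => [n /(_ [set n | in_sgp n])|n /= /in_sgpP[i [j ->]]].
  apply; split.
    split; first by apply/in_sgpP; exists 0%N, 0%N; rewrite !muln0.
    move=> x y /= /in_sgpP[i [j ->]] /in_sgpP[i' [j' ->]].
    by apply/in_sgpP; exists (i + i')%N, (j + j')%N; ring.
  by move=> _ /= [->|->]; apply/in_sgpP; [exists 1%N, 0%N|exists 0%N, 1%N]; lia.
move=> S [[S0 SD] sub].
have SM c k : S c -> S (c * k)%N.
  by move=> Sc; elim: k => [|k IH]; rewrite ?muln0 ?mulnS //; exact: SD.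
by apply: SD; apply: SM; apply: sub; [left|right].
Qed.

Lemma weierstrass_sgp :
  weierstrass_semigroup (generated_semigroup a b) ((a - 1) * (b - 1) %/ 2).
Proof.
split.
  split=> [S [[]]//|x y Sx Sy S hS]; have [[_ SD] _] := hS.
  by apply: SD; [exact: Sx|exact: Sy].
rewrite generated_semigroupE; set m := ((a - 1) * (b - 1))%N.
(* All gaps lie below [m], and the reversal of ['I_m] exchanges gaps and members, so exactly half of
   ['I_m] are gaps. *)
pose G := [set i : 'I_m | ~~ in_sgp i]%SET.
have symG (i : 'I_m) : in_sgp (rev_ord i) = ~~ in_sgp i.
  apply: sgp_sym; rewrite /=; have := ltn_ord i; rewrite /m; nia.
have cG : (#|G| * 2 = m)%N.
  rewrite muln2 -addnn -{2}(card_imset _ (@rev_ord_inj m)).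
  have -> : [set rev_ord x | x in G]%SET = (~: G)%SET.
    apply/setP => i; rewrite !inE -{1}(rev_ordK i) mem_imset ?inE ?symG //.
    exact: rev_ord_inj.
  by rewrite cardsC card_ord.
have <- : #|G| = (m %/ 2)%N by rewrite -[X in (X %/ _)%N]cG mulnK.
pose f := nth 0%N (map val (enum G)).
have sz : size (map val (enum G)) = #|G| by rewrite size_map -cardE.
have -> : ~` [set n | in_sgp n] = [set f i | i in `I_#|G|].
  apply/seteqP; split => [n /= nH|_ [i /= iG <-] /=]; last first.
    have : f i \in map val (enum G) by rewrite mem_nth ?sz.
    by case/mapP => x; rewrite mem_enum inE => /negP ? ->.
  have nm : (n < m)%N.
    by rewrite ltnNge; apply/negP => mn; apply: nH; exact: sgp_large.
  have nG : n \in map val (enum G).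
    by apply/mapP; exists (Ordinal nm); rewrite // mem_enum inE; apply/negP.
  by exists (index n (map val (enum G))); rewrite /= -?sz ?index_mem // /f nth_index.
apply: inj_card_eq => i j; rewrite !inE /= => iG jG /eqP.
rewrite nth_uniq ?sz //; first by move/eqP.
by rewrite map_inj_uniq ?enum_uniq //; exact: val_inj.
Qed.

End NumericalSemigroup.

(** * Valuations *)

Section Valuations.

Variables (K L : fieldType) (cst : {rmorphism K -> L}) (pt : eqType).
Variable ord : pt -> L -> int.

(** Gives [0] infinite order, whatever value [ord] takes there. *)
Definition vge (R : pt) (n : int) (f : L) : bool := (f == 0) || (n <= ord R f).

(** Discrete valuations trivial on the constants, with the constants as residue field and all
    integers as values. *)
Record curve_valuations : Prop := CurveValuations {
  cv_ordM : forall R (f g : L), f != 0 -> g != 0 -> ord R (f * g) = ord R f + ord R g;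
  cv_vgeD : forall R n (f g : L), vge R n f -> vge R n g -> vge R n (f + g);
  cv_ord_cst : forall R c, c != 0 -> ord R (cst c) = 0;
  cv_residue : forall R (f : L), vge R 0 f -> exists c, vge R 1 (f - cst c);
  cv_unif : forall R, exists2 t, t != 0 & ord R t = 1 }.

Hypothesis V : curve_valuations.

Lemma vge_neq0 R n (f : L) : f != 0 -> vge R n f = (n <= ord R f).
Proof. by rewrite /vge => /negPf->. Qed.

Lemma vge_ord R (f : L) : vge R (ord R f) f.
Proof. by rewrite /vge lexx orbT. Qed.

Lemma vge0 R n : vge R n 0.
Proof. by rewrite /vge eqxx. Qed.

Lemma vgeW R m n (f : L) : n <= m -> vge R m f -> vge R n f.
Proof. by rewrite /vge => nm /orP[->//|/(le_trans nm)->]; rewrite orbT. Qed.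

Lemma vgeM R m n (f g : L) : vge R m f -> vge R n g -> vge R (m + n) (f * g).
Proof.
have [->|f0] := eqVneq f 0; first by move=> _ _; rewrite mul0r vge0.
have [->|g0] := eqVneq g 0; first by move=> _ _; rewrite mulr0 vge0.
rewrite !vge_neq0 ?mulf_neq0 // (cv_ordM V) //; exact: lerD.
Qed.

Lemma vge_cst R c : vge R 0 (cst c).
Proof.
have [->|c0] := eqVneq c 0; first by rewrite rmorph0 vge0.
by rewrite /vge (cv_ord_cst V) // lexx orbT.
Qed.

Lemma vgeZ R n c (f : L) : vge R n f -> vge R n (cst c * f).
Proof. by move=> vf; rewrite -[n]add0r vgeM ?vge_cst. Qed.

Lemma vgeN R n (f : L) : vge R n f -> vge R n (- f).
Proof. by move=> /(vgeZ (-1)); rewrite rmorphN1 mulN1r. Qed.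

Lemma vgeB R n (f g : L) : vge R n f -> vge R n g -> vge R n (f - g).
Proof. by move=> vf /vgeN; exact: cv_vgeD. Qed.

Lemma ord1 R : ord R 1 = 0.
Proof. by rewrite -(rmorph1 cst) (cv_ord_cst V) ?oner_neq0. Qed.

Lemma ordV R (f : L) : f != 0 -> ord R f^-1 = - ord R f.
Proof.
move=> f0; apply/eqP; rewrite -addr_eq0 -(cv_ordM V) ?invr_eq0 //.
by rewrite mulVf // ord1.
Qed.

Lemma ordX R (f : L) n : f != 0 -> ord R (f ^+ n) = ord R f * n%:Z.
Proof.
move=> f0; elim: n => [|n IH]; first by rewrite mulr0 ord1.
by rewrite exprS (cv_ordM V) ?expf_neq0 // IH intS mulrDr mulr1.
Qed.

Lemma vgeX R m n (f : L) : vge R m f -> vge R (m * n%:Z) (f ^+ n).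
Proof.
move=> vf; elim: n => [|n IH]; first by rewrite mulr0 /vge ord1 lexx orbT.
by rewrite exprS intS mulrDr mulr1 vgeM.
Qed.

Lemma ordD_lt R (f g : L) : f != 0 -> vge R (ord R f + 1) g ->
  f + g != 0 /\ ord R (f + g) = ord R f.
Proof.
move=> f0 vg; have nvge : ~~ vge R (ord R f + 1) (f + g).
  apply/negP => /vgeB /(_ vg); rewrite addrK vge_neq0 //; lia.
have s0 : f + g != 0 by apply: contraNneq nvge => ->; exact: vge0.
have vg' : vge R (ord R f) g by apply: vgeW vg; lia.
have := cv_vgeD V (vge_ord R f) vg'; move: nvge; rewrite !vge_neq0 //.
move=> nle le; split=> //; lia.
Qed.

(** The quotient [f / h] is a unit at [R], so its residue is a nonzero constant. *)
Lemma leading_term R (f h : L) : f != 0 -> h != 0 -> ord R f = ord R h ->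
  exists2 c, c != 0 & vge R (ord R f + 1) (f - cst c * h).
Proof.
move=> f0 h0 e; have fh0 : f / h != 0 by rewrite mulf_neq0 ?invr_eq0.
have ofh : ord R (f / h) = 0 by rewrite (cv_ordM V) ?invr_eq0 // ordV // e subrr.
have [|c vc] := @cv_residue V R (f / h); first by rewrite /vge ofh lexx orbT.
exists c.
  apply: contraTneq vc => ->; rewrite rmorph0 subr0 vge_neq0 // ofh; lia.
have := vgeM (vge_ord R h) vc; rewrite e mulrBr.
by rewrite mulrC divfK // [h * _]mulrC.
Qed.

Definition regular_off (P : pt) (f : L) : Prop := forall R, R != P -> vge R 0 f.

Section Regular.

Variable P : pt.

Lemma regD (f g : L) : regular_off P f -> regular_off P g -> regular_off P (f + g).
Proof. by move=> rf rg R RP; apply: (cv_vgeD V); [exact: rf|exact: rg]. Qed.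

Lemma regB (f g : L) : regular_off P f -> regular_off P g -> regular_off P (f - g).
Proof. by move=> rf rg R RP; apply: vgeB; [exact: rf|exact: rg]. Qed.

Lemma regM (f g : L) : regular_off P f -> regular_off P g -> regular_off P (f * g).
Proof. by move=> rf rg R RP; apply: (@vgeM R 0 0); [exact: rf|exact: rg]. Qed.

Lemma reg_cst c : regular_off P (cst c).
Proof. by move=> R _; exact: vge_cst. Qed.

Lemma regX (f : L) n : regular_off P f -> regular_off P (f ^+ n).
Proof. by move=> rf R RP; rewrite -(mul0r n%:Z) vgeX ?rf. Qed.

Lemma reg0 : regular_off P 0.
Proof. by move=> R _; exact: vge0. Qed.

End Regular.

(** * Polynomials evaluated at a function *)

Local Notation "phi <[ y ]>" := ((map_poly cst phi).[y]) (at level 2).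

Lemma evX (phi : {poly K}) (y : L) : (phi * 'X)<[y]> = phi<[y]> * y.
Proof. by rewrite rmorphM /= map_polyX hornerMX. Qed.

Lemma evD (phi psi : {poly K}) (y : L) : (phi + psi)<[y]> = phi<[y]> + psi<[y]>.
Proof. by rewrite rmorphD hornerD. Qed.

Lemma evC c y : (c%:P)<[y]> = cst c.
Proof. by rewrite map_polyC hornerC. Qed.

Lemma evZXn c n (y : L) : (c *: 'X^n)<[y]> = cst c * y ^+ n.
Proof. by rewrite map_polyZ map_polyXn hornerZ hornerXn. Qed.

Lemma evB (phi psi : {poly K}) (y : L) :
  (phi - psi)<[y]> = phi<[y]> - psi<[y]>.
Proof. by rewrite rmorphB hornerD hornerN. Qed.

Lemma evXn n (y : L) : ('X^n)<[y]> = y ^+ n.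
Proof. by rewrite map_polyXn hornerXn. Qed.

Lemma vge_ev R (phi : {poly K}) (y : L) : vge R 0 y -> vge R 0 phi<[y]>.
Proof.
move=> vy; elim/poly_ind: phi => [|phi c IH].
  by rewrite rmorph0 horner0 vge0.
by rewrite evD evX evC (cv_vgeD V) ?vge_cst // (@vgeM R 0 0).
Qed.

Lemma reg_ev P (phi : {poly K}) (y : L) : regular_off P y -> regular_off P phi<[y]>.
Proof. by move=> ry R RP; apply/vge_ev/ry. Qed.

Lemma poly_const (phi : {poly K}) : exists psi, phi = psi * 'X + (phi`_0)%:P.
Proof.
elim/poly_ind: phi => [|phi c _].
  by exists 0; rewrite mul0r coef0 polyC0 addr0.
by exists phi; rewrite coefD coefMX coefC eqxx add0r.
Qed.

(** A nonzero constant coefficient would be a unit at [R], whereas [y] and the value of [phi] both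
    vanish there. *)
Lemma ev_root R (phi : {poly K}) (y : L) : vge R 1 y -> vge R 1 phi<[y]> ->
  exists2 psi, phi = psi * 'X & phi<[y]> = psi<[y]> * y.
Proof.
move=> vy; have [psi ->] := poly_const phi; rewrite evD evX evC => v1.
have v2 : vge R 1 (psi<[y]> * y).
  by rewrite -[1]add0r vgeM // vge_ev // (vgeW _ vy).
suff -> : phi`_0 = 0 by exists psi; rewrite ?polyC0 ?addr0 // rmorph0 addr0.
apply: contraTeq v1 => c0; apply/negP => /vgeB /(_ v2).
by rewrite addrC addKr vge_neq0 ?fmorph_eq0 // (cv_ord_cst V).
Qed.

(** Horner induction: a nonzero value times [y] has a pole at [R], and adding a constant does not
    change its order. *)
Lemma ord_ev R (phi : {poly K}) (y : L) : phi != 0 -> ord R y < 0 -> y != 0 ->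
  phi<[y]> != 0 /\ ord R phi<[y]> = ord R y * (size phi).-1%:Z.
Proof.
move=> + oy y0; elim/poly_ind: phi => [|phi c IH]; first by rewrite eqxx.
have [->|p0] := eqVneq phi 0.
  rewrite mul0r add0r polyC_eq0 => c0.
  by rewrite evC fmorph_eq0 c0 (cv_ord_cst V) // size_polyC c0 mulr0.
move=> _; have [q0 oq] := IH p0; rewrite evD evX evC.
have o : ord R (phi<[y]> * y) = ord R y * (size phi)%:Z.
  rewrite (cv_ordM V) // oq; have := p0; rewrite -size_poly_gt0.
  by case: (size phi) => // k _ /=; rewrite intS mulrDr mulr1 addrC.
rewrite size_MXaddC (negPf p0) /= -o; apply: ordD_lt.
  by rewrite mulf_neq0.
rewrite (vgeW _ (vge_cst R c)) // o.
by have := p0; rewrite -size_poly_gt0; nia.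
Qed.

End Valuations.

(** * Two points with the same semigroup *)

Section TwoPoints.

Variables (K L : fieldType) (cst : {rmorphism K -> L}) (pt : eqType).
Variable ord : pt -> L -> int.
Hypothesis V : curve_valuations cst ord.

Hypothesis finite_divisors : forall f : L, f != 0 ->
  exists s : seq pt, forall R, R \notin s -> ord R f = 0.

Local Notation "phi <[ y ]>" := ((map_poly cst phi).[y]) (at level 2).
Local Notation vge := (vge ord).

Variables (P Q : pt) (a b : nat).
Hypotheses (a_gt2 : (2 < a)%N) (lt_ab : (a + 2 <= b)%N) (co_ab : coprime a b).

Local Notation A := (regular_off ord P).

Hypothesis pole_sgp : forall (f : L) (n : nat), f != 0 -> A f ->
  ord P f = - n%:Z -> in_sgp a b n.

Section Coordinates.

Variables x y : L.
Hypotheses (x0 : x != 0) (y0 : y != 0) (Ax : A x) (Ay : A y).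
Hypotheses (ord_x : ord P x = - a%:Z) (ord_y : ord P y = - b%:Z).

Let a_gt0 : (0 < a)%N. Proof. lia. Qed.
Let b_gt0 : (0 < b)%N. Proof. lia. Qed.

Let y_pole : ord P y < 0.
Proof. by rewrite ord_y; lia. Qed.

Lemma ord_monomial i j :
  [/\ x ^+ i * y ^+ j != 0, A (x ^+ i * y ^+ j) &
      ord P (x ^+ i * y ^+ j) = - (a * i + b * j)%N%:Z].
Proof.
split; first by rewrite mulf_neq0 ?expf_neq0.
  by apply: (regM V); apply: (regX V).
rewrite (cv_ordM V) ?expf_neq0 // !(ordX V) // ord_x ord_y; lia.
Qed.

(** Let [g] be [f] minus its value at [P]. If [g] were nonzero, a high power of it times a monomial
    would have pole order 1, which is a gap because [a] and [b] exceed 1. *)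
Lemma regular_constant f : A f -> vge P 0 f -> exists c, f = cst c.
Proof.
move=> Af /(cv_residue V)[c]; set g := f - cst c => vg.
have Ag : A g by apply/(regB V)/(reg_cst V).
exists c; apply/eqP; rewrite -subr_eq0 -/g; apply/negPn/negP => g0.
have [m om] : exists m : nat, ord P g = m.+1%:Z.
  by move: vg; rewrite vge_neq0 // => o; exists (`|ord P g|.-1)%N; lia.
(* The monomial has one pole more than [g ^+ (a * b)] has zeros at [P]; the exponent [a * b] puts
   its pole order beyond all gaps. *)
have /(in_sgpP _ a_gt0) [i [j e]] : in_sgp a b (m.+1 * (a * b) + 1).
  by apply: sgp_large => //; nia.
have [z0 Az oz] := ord_monomial i j.
have : in_sgp a b 1.
  apply: (pole_sgp (f := x ^+ i * y ^+ j * g ^+ (a * b))).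
  - by rewrite mulf_neq0 ?expf_neq0.
  - by apply: (regM V) => //; exact: (regX V).
  - by rewrite (cv_ordM V) ?expf_neq0 // oz (ordX V) // om -e; lia.
by case/(in_sgpP _ a_gt0) => [[|i'] [[|j'] ]]; nia.
Qed.

(* Division by x in A, read off the expansion of f in the monomials x^i y^j. *)
Lemma expand (N : nat) f : A f -> vge P (- N%:Z) f -> exists phi F,
  [/\ A F, f = phi<[y]> + x * F & forall j, phi`_j != 0 -> (b * j <= N)%N].
Proof.
elim: N f => [|N IH] f Af vf.
  have [c ->] := regular_constant Af vf; exists c%:P, 0; split.
  - exact: reg0.
  - by rewrite evC mulr0 addr0.
  - by move=> [|j]; rewrite coefC /= ?muln0 // eqxx.
have [vfN|] := boolP (vge P (- N%:Z) f).
  have [phi [F [AF -> hphi]]] := IH _ Af vfN.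
  by exists phi, F; split=> // j /hphi; lia.
move=> nvf; have f0 : f != 0 by apply: contraNneq nvf => ->; exact: vge0.
have oF : ord P f = - N.+1%:Z by move: vf nvf; rewrite !vge_neq0 //; lia.
have /(in_sgpP _ a_gt0) [i [j e]] := pole_sgp f0 Af oF.
have [z0 Az oz] := ord_monomial i j; rewrite -e -oF in oz.
have [c _ vc] := leading_term V f0 z0 (esym oz).
have [||phi [F [AF ef hphi]]] := IH (f - cst c * (x ^+ i * y ^+ j)).
- by apply: (regB V) => //; apply: (regM V) => //; exact: (reg_cst V).
- by apply: vgeW vc; rewrite oF; lia.
have {}ef : f = phi<[y]> + x * F + cst c * (x ^+ i * y ^+ j).
  by rewrite -ef subrK.
(* A pure power of [y] goes into [phi]; any other monomial is divisible by [x] and goes into [F]. *)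
case: i e {z0 Az oz vc} ef => [|i] e ef.
  exists (phi + c *: 'X^j), F; split=> //.
    by rewrite ef evD evZXn expr0 mul1r; ring.
  move=> l; rewrite coefD coefZ coefXn.
  have [->|_] := eqVneq l j; first by rewrite e; lia.
  by rewrite mulr0 addr0 => /hphi; lia.
exists phi, (F + cst c * (x ^+ i * y ^+ j)); split=> [||l /hphi]; last lia.
  apply: (regD V) => //; apply: (regM V); first exact: (reg_cst V).
  by have [] := ord_monomial i j.
by rewrite ef exprS; ring.
Qed.

(** At each possible pole other than [P], a power of [x] minus its value there cancels the pole and
    stays in [A]. *)
Lemma clear_poles f : f != 0 -> exists h, [/\ h != 0, A h & A (f * h)].
Proof.
move=> f0; have [s fs] := finite_divisors f0.
have {fs} : forall R, R \notin s -> R != P -> vge R 0 f.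
  by move=> R /fs oR _; rewrite /vge oR lexx orbT.
elim: s f f0 => [|R0 s IH] f f0 fs.
  exists 1; rewrite oner_neq0 mulr1; split=> // R RP; last exact: fs.
  by rewrite -(rmorph1 cst) vge_cst.
have [e|R0P] := eqVneq R0 P.
  by apply: IH => // R Rs RP; apply: fs => //; rewrite inE negb_or e RP.
have [c vc] := cv_residue V (Ax R0P).
have xc0 : x - cst c != 0.
  apply/eqP => /subr0_eq ex; move: ord_x x0; rewrite ex fmorph_eq0.
  by move=> oc /(cv_ord_cst V P); rewrite oc; lia.
have Axc : A (x - cst c) by apply: (regB V) => //; exact: (reg_cst V).
set h0 := (x - cst c) ^+ `|ord R0 f|.
have Ah0 : A h0 by exact: (regX V).
have h00 : h0 != 0 by rewrite expf_neq0.
have [||h [hn0 Ah Afh]] := IH (f * h0); first by rewrite mulf_neq0.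
  move=> R Rs RP; have [->|RR0] := eqVneq R R0; last first.
    apply: (@vgeM _ _ _ _ _ V R 0 0); last exact: Ah0.
    by apply: fs => //; rewrite inE negb_or RR0.
  rewrite vge_neq0 ?mulf_neq0 // (cv_ordM V) // (ordX V) //.
  by move: vc; rewrite vge_neq0 //; nia.
exists (h0 * h); split; rewrite ?mulf_neq0 ?mulrA //.
exact: (regM V).
Qed.

Hypotheses (QP : Q != P) (Qx : vge Q 1 x) (Qy : vge Q 1 y).

(** The ideal of [Q] in [A] is generated by [x] and [y]: in the expansion of [f], the polynomial
    part vanishes at [Q], hence has no constant term. *)
Lemma expand_at_Q f : A f -> vge Q 1 f ->
  exists phi F, A F /\ f = phi<[y]> * y + x * F.
Proof.
move=> Af Qf; have vf : vge P (- `|ord P f|%N%:Z) f.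
  by apply: vgeW (vge_ord _ _ _); clear; lia.
have [phi [F [AF ef _]]] := expand Af vf.
have Qphi : vge Q 1 phi<[y]>.
  have -> : phi<[y]> = f - x * F by rewrite ef addrK.
  by apply: (vgeB V) => //; rewrite -[1]addr0 (vgeM V) ?AF.
have [psi _ epsi] := ev_root V Qy Qphi.
by exists psi, F; rewrite ef epsi.
Qed.

(* Modulo x the monic relation of degree a satisfied by y is divisible by y;
   w is the quotient divided by x. *)
Lemma proper_multiplier : exists w,
  [/\ w != 0, ~ A w & forall f, A f -> vge Q 1 f -> A (f * w)].
Proof.
have [xb0 Axb oxb] := ord_monomial b 0; rewrite mulr1 in xb0 Axb oxb.
have [ya0 Aya oya] := ord_monomial 0 a; rewrite mul1r in ya0 Aya oya.
have eo : ord P (y ^+ a) = ord P (x ^+ b) by rewrite oxb oya; lia.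
have [c _ vc] := leading_term V ya0 xb0 eo.
(* Both [y ^+ a] and [x ^+ b] have pole order [a * b]; once their leading terms cancel, [phi] has
   degree below [a], so ['X^a - phi] is monic. *)
have [||phi [F [AF ef hphi]]] := @expand (a * b - 1) (y ^+ a - cst c * x ^+ b).
- by apply: (regB V) => //; apply: (regM V) => //; exact: (reg_cst V).
- by apply: vgeW vc; rewrite oya; nia.
have sphi : (size phi <= a)%N.
  apply/leq_sizeP => j aj; apply/eqP/negPn/negP => /hphi.
  by clear - a_gt2 lt_ab aj; nia.
set G := cst c * x ^+ (b - 1) + F.
have AG : A G.
  by apply: (regD V) => //; apply: (regM V); [exact: (reg_cst V)|exact: (regX V)].
have eG : ('X^a - phi)<[y]> = x * G.
  rewrite evB evXn /G mulrDr.
  have -> : x * (cst c * x ^+ (b - 1)) = cst c * x ^+ b.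
    by rewrite mulrCA -exprS subn1 prednK.
  by apply/eqP; rewrite subr_eq; apply/eqP; rewrite addrAC -addrA -ef; ring.
have Qf : vge Q 1 ('X^a - phi)<[y]>.
  by rewrite eG -[1]addr0 (vgeM V) ?AG.
have [psi epsi evpsi] := ev_root V Qy Qf.
have spsi : size psi = a.
  have p0 : psi != 0.
    apply/eqP => p0; move/eqP: epsi; rewrite p0 mul0r subr_eq0 => /eqP e.
    by move: sphi; rewrite -e size_polyXn ltnn.
  apply/eqP; rewrite -eqSS -size_mulX // -epsi size_polyDl ?size_polyXn //.
  by rewrite size_polyN.
have p0 : psi != 0 by rewrite -size_poly_gt0 spsi.
have [w0 ow] := ord_ev V p0 y_pole y0.
exists (psi<[y]> / x); split; first by rewrite mulf_neq0 ?invr_eq0.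
  (* As [psi] has degree [a - 1], the quotient has pole order [b * (a - 1) - a], the Frobenius
     number. *)
  have lt : (0 < a - 1 < a)%N by clear - a_gt2; lia.
  have le : (a <= b * (a - 1))%N by clear - a_gt2 lt_ab; nia.
  move=> Aw; have /negP := sgp_gap a_gt0 b_gt0 co_ab lt le; apply.
  apply: (pole_sgp (f := psi<[y]> / x)) => //.
    by rewrite mulf_neq0 ?invr_eq0.
  rewrite (cv_ordM V) ?invr_eq0 // (ordV V) // ow ord_x ord_y spsi.
  by clear - a_gt2 lt_ab; nia.
move=> f Af /(expand_at_Q Af)[chi [F' [AF' ->]]].
have -> : (chi<[y]> * y + x * F') * (psi<[y]> / x) =
          chi<[y]> * (psi<[y]> * y / x) + F' * psi<[y]> by field.
rewrite -evpsi eG [x * G]mulrC mulfK //.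
by apply: (regD V); apply: (regM V) => //; exact: (reg_ev V).
Qed.

(* If every product of w with a function vanishing at Q vanished again at Q, then
   x w^n would be in A for all n, and w would have no pole outside P. *)
Lemma local_parameter : ~ (vge Q 2 x /\ vge Q 2 y).
Proof.
move=> [x2 y2]; have [w [w0 nAw Aw]] := proper_multiplier.
have [m [Am Qm Qmw]] : exists m, [/\ A m, vge Q 1 m & ~~ vge Q 1 (m * w)].
  apply/not_existsP => no; apply: nAw => R RP.
  have wn n : A (x * w ^+ n) /\ vge Q 1 (x * w ^+ n).
    elim: n => [|n [An Qn]]; first by rewrite mulr1.
    rewrite exprSr mulrA; split; first exact: Aw.
    apply/negPn/negP => nQ; apply: (no (x * w ^+ n)); split=> //.
  (* With this exponent, a pole of [w] at [R] would outweigh any zero of [x] there. *)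
  have [/(_ R RP)] := wn (`|ord R x|.+1)%N.
  rewrite !vge_neq0 ?mulf_neq0 ?expf_neq0 // (cv_ordM V) ?expf_neq0 //.
  by rewrite (ordX V) //; clear; nia.
have m0 : m != 0 by apply: contraNneq Qmw => ->; rewrite mul0r vge0.
have := Aw _ Am Qm Q QP; move: Qmw Qm; rewrite !vge_neq0 ?mulf_neq0 //.
rewrite (cv_ordM V) // => o1 o2 o3.
set e := ord Q m in o1 o2 o3.
have {o1 o3} ow : ord Q w = - e by clear - o1 o2 o3; lia.
(* Multiplication by [w] lowers the order at [Q] by [e] and keeps a function vanishing at [Q] inside
   [A]; descent gives divisibility by [e]. *)
have div n f : A f -> f != 0 -> ord Q f <= n%:Z -> exists q, ord Q f = e * q.
  elim: n f => [|n IH] f Af f0 le.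
    by exists 0; have := Af Q QP; rewrite vge_neq0 //; clear - le; lia.
  have [Qf|nQf] := boolP (vge Q 1 f); last first.
    exists 0; have := Af Q QP; move: nQf; rewrite !vge_neq0 //; clear; lia.
  have [|q oq] := IH (f * w) (Aw f Af Qf) (mulf_neq0 f0 w0).
    by rewrite (cv_ordM V) // ow; clear - le o2; lia.
  by exists (q + 1); move: oq; rewrite (cv_ordM V) // ow; clear; lia.
have {}div f : A f -> f != 0 -> exists q, ord Q f = e * q.
  by move=> Af f0; apply: (div `|ord Q f|%N) => //; clear; lia.
have [t t0 ot] := cv_unif V Q.
have [h [h0 Ah Ath]] := clear_poles t0.
have [q oq] := div _ Ath (mulf_neq0 t0 h0); have [q' oq'] := div _ Ah h0.
(* A uniformizer at [Q] is a quotient of two elements of [A], so [e] divides 1. *)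
have e1 : e = 1.
  have : (e %| 1)%Z.
    apply/dvdzP; exists (q - q'); rewrite mulrC mulrBr -oq -oq' (cv_ordM V) // ot.
    by ring.
  by rewrite dvdz1; clear - o2; lia.
have Qm : vge Q 1 m by rewrite vge_neq0 // -/e e1.
(* Yet [m] lies in the ideal generated by [x] and [y], all of whose elements vanish doubly at
   [Q]. *)
have [phi [F [AF em]]] := expand_at_Q Am Qm.
have : vge Q 2 m.
  rewrite em; apply: (cv_vgeD V).
    by rewrite -[2]add0r; apply: (vgeM V) => //; apply/(vge_ev V)/Ay.
  by rewrite -[2]addr0; apply: (vgeM V) => //; exact: AF.
by rewrite vge_neq0 // -/e e1.
Qed.

(** * Orders of the coordinates at the second point *)

Variables u v : L.
Hypotheses (u0 : u != 0) (Qu : regular_off ord Q u) (ord_u : ord Q u = - a%:Z).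
Hypotheses (v0 : v != 0) (Qv : regular_off ord Q v) (ord_v : ord Q v = - b%:Z).

(* Otherwise w = h u has a simple pole at Q and pole order at P at most 2g - 2,
   where x w reduces modulo x to a polynomial in y of degree less than a - 1
   which y multiplies into x A. *)
Lemma no_ord_pred h (N : nat) : (N + a + b < a * b)%N ->
  A h -> h != 0 -> vge P (- N%:Z) h -> ord Q h <> a%:Z - 1.
Proof.
move=> ltN Ah h0 Ph oh; set w := h * u.
have w0 : w != 0 by rewrite mulf_neq0.
have ow : ord Q w = - 1 by rewrite (cv_ordM V) // oh ord_u; clear; lia.
have nAw : ~ A w by move=> /(_ Q QP); rewrite vge_neq0 // ow.
have Pw : vge P (- N%:Z) w.
  by rewrite -[- N%:Z]addr0; apply: (vgeM V) => //; apply: Qu; rewrite eq_sym.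
(* The zero of [z] at [Q] absorbs the simple pole of [w]. *)
have Azw z : A z -> vge Q 1 z -> A (z * w).
  move=> Az Qz R RP; have [->|RQ] := eqVneq R Q.
    rewrite -[0](_ : 1 + -1 = 0) //; apply: (vgeM V) => //.
    by rewrite vge_neq0 // ow.
  rewrite -[0]addr0; apply: (vgeM V); first exact: Az.
  by rewrite -[0]addr0; apply: (vgeM V); [exact: Ah|exact: Qu].
have Pxw : vge P (- (N + a)%N%:Z) (x * w).
  by rewrite PoszD opprD addrC (vgeM V) // -ord_x vge_ord.
have [phi [F [AF exw hphi]]] := expand (Azw x Ax Qx) Pxw.
(* The pole order of [x * w] is at most [N + a], which is less than [b * (a - 1)]. *)
have sphi : (size phi <= a - 1)%N.
  apply/leq_sizeP => j aj; apply/eqP/negPn/negP => /hphi.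
  by clear - ltN lt_ab aj a_gt2; nia.
have [p0|p0] := eqVneq phi 0.
  apply: nAw; suff -> : w = F by [].
  by apply: (mulfI x0); rewrite exw p0 rmorph0 horner0 add0r.
have [e0 oe] := ord_ev V p0 y_pole y0.
(* This element of [A] will have pole order [b * s - a] with [s = size phi] and [0 < s < a], a
   gap. *)
have eG : y * w - y * F = phi<[y]> * y / x.
  apply: (mulfI x0); rewrite [x * (_ / _)]mulrC divfK //.
  by rewrite mulrBr mulrCA exw; ring.
have AG : A (y * w - y * F).
  by apply: (regB V); [exact: Azw|exact: (regM V)].
rewrite eG in AG.
move: sphi oe; have := p0; rewrite -size_poly_gt0.
set s := size phi => s_gt0 sphi oe.
have lt : (0 < s < a)%N by clear - s_gt0 sphi a_gt2; lia.
have le : (a <= b * s)%N by clear - s_gt0 lt_ab; nia.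
have /negP := sgp_gap a_gt0 b_gt0 co_ab lt le; apply; apply: pole_sgp AG _.
  by rewrite !mulf_neq0 ?invr_eq0.
rewrite !(cv_ordM V) ?mulf_neq0 ?invr_eq0 // (ordV V) // oe ord_x ord_y.
by clear - le s_gt0; nia.
Qed.

Lemma ord_y_at_Q : ord Q y = 1 /\ a%:Z <= ord Q x.
Proof.
have x1 : 1 <= ord Q x by move: Qx; rewrite vge_neq0.
have y1 : 1 <= ord Q y by move: Qy; rewrite vge_neq0.
have xN1 : ord Q x <> 1.
  (* The degree bound becomes [a * a + b < a * b], which follows from [a + 2 <= b] and [2 < a]. *)
  move=> ox; have [z0 Az oz] := ord_monomial (a - 1) 0.
  apply: (no_ord_pred (N := a * (a - 1)) _ Az z0); first nia.
    by rewrite vge_neq0 // oz muln0 addn0.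
  by rewrite mulr1 (ordX V) // ox; lia.
have oy : ord Q y = 1.
  have := local_parameter; rewrite !vge_neq0 //; lia.
split=> //; rewrite leNgt; apply/negP => xa.
have [e ex] : exists e : nat, ord Q x = e%:Z by exists `|ord Q x|%N; lia.
(* This monomial has order [e + (a - 1 - e)] at [Q]. Since [e] is at least 2, [2 * a < b * e], which
   is the required bound on its pole. *)
have [z0 Az oz] := ord_monomial 1 (a - 1 - e).
apply: (no_ord_pred (N := a * 1 + b * (a - 1 - e)) _ Az z0).
- have ea : (e + (a - 1 - e) + 1 = a)%N by lia.
  have eab : (a * b = b * e + b * (a - 1 - e) + b)%N by rewrite -{1}ea; ring.
  have : (b * 2 <= b * e)%N by rewrite leq_mul2l; lia.
  by clear - eab lt_ab; lia.
- by rewrite vge_neq0 // oz.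
by rewrite (cv_ordM V) ?expf_neq0 // !(ordX V) // oy ex; lia.
Qed.

Lemma ord_x_at_Q : ord Q x = a%:Z.
Proof.
have [_ xa] := ord_y_at_Q; have PQ : P != Q by rewrite eq_sym.
have [c vc] := cv_residue V (Qu PQ).
have [u'0 ou'] : u - cst c != 0 /\ ord Q (u - cst c) = - a%:Z.
  rewrite -ord_u; apply: (ordD_lt V) => //; apply: (vgeN V).
  by apply: vgeW (vge_cst V Q c); rewrite ord_u; clear - a_gt2; lia.
set u' := u - cst c in vc u'0 ou'.
have xu0 : x * u' != 0 by rewrite mulf_neq0.
have Axu : A (x * u').
  move=> R RP; have [->|RQ] := eqVneq R Q.
    by rewrite vge_neq0 // (cv_ordM V) // ou'; clear - xa; lia.
  rewrite -[0]addr0; apply: (vgeM V); first exact: Ax.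
  by apply: (vgeB V); [exact: Qu|exact: vge_cst].
have oP : ord P (x * u') = - a%:Z + ord P u' by rewrite (cv_ordM V) // ord_x.
have u1 : 1 <= ord P u' by move: vc; rewrite vge_neq0.
(* The zero of [u'] leaves a pole of order below [a], and 0 is the only member below [a]. *)
have Pxu : vge P 0 (x * u').
  rewrite vge_neq0 // leNgt; apply/negP => lt0.
  have /in_sgpP : in_sgp a b `|ord P (x * u')|.
    by apply: (pole_sgp xu0 Axu); clear - lt0; lia.
  case=> // i [j e]; have : (a * i + b * j < a)%N by clear - e lt0 oP u1; lia.
  have {lt0} : (0 < a * i + b * j)%N by clear - e lt0; lia.
  by clear e; case: i j => [|i] [|j]; clear - lt_ab; nia.
have [d ed] := regular_constant Axu Pxu.
have d0 : d != 0 by move: xu0; rewrite ed fmorph_eq0.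
by have := cv_ord_cst V Q d0; rewrite -ed (cv_ordM V) // ou'; clear; lia.
Qed.

Lemma coordinates_contra (k r : nat) : b = (k * a + r)%N -> (0 < r)%N ->
  (r + 2 <= a)%N -> False.
Proof.
move=> eb r_gt0 ra; have [oy _] := ord_y_at_Q; have ox := ord_x_at_Q.
have PQ : P != Q by rewrite eq_sym.
have k_gt0 : (0 < k)%N by nia.
set z := v * x ^+ k.+1.
have z0 : z != 0 by rewrite mulf_neq0 ?expf_neq0.
have oz : ord Q z = a%:Z - r%:Z.
  by rewrite (cv_ordM V) ?expf_neq0 // (ordX V) // ox ord_v; clear - eb; nia.
have Az : A z.
  move=> R RP; have [->|RQ] := eqVneq R Q; first by rewrite vge_neq0 // oz; clear - ra; lia.
  by rewrite -[0]addr0; apply: (vgeM V); [exact: Qv|exact: (regX V _ Ax)].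
have Pz : vge P (- (a * k.+1)%N%:Z) z.
  rewrite -[- _]add0r; apply: (vgeM V); first exact: Qv.
  by rewrite vge_neq0 ?expf_neq0 // (ordX V) // ord_x; clear; lia.
have [phi [F [AF ez hphi]]] := expand Az Pz.
have Qxf : vge Q a%:Z (x * F).
  by rewrite -[a%:Z]addr0; apply: (vgeM V); [rewrite vge_neq0 ?ox|exact: AF].
have Qphi : vge Q 1 phi<[y]>.
  have -> : phi<[y]> = z - x * F by rewrite ez addrK.
  by apply: (vgeB V); [rewrite vge_neq0 // oz; clear - ra|apply: vgeW Qxf; clear - a_gt2]; lia.
have [psi epsi evpsi] := ev_root V Qy Qphi.
(* The pole order [a * k.+1 = b + a - r] is below [2 * b], so [phi] is at most linear and [psi] is
   constant. *)
have spsi : (size psi <= 1)%N.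
  apply/leq_sizeP => j j1; apply/eqP/negPn/negP => pj.
  have /hphi : phi`_j.+1 != 0 by rewrite epsi coefMX.
  by clear - j1 eb lt_ab a_gt2 k_gt0 r_gt0 ra; nia.
have ep : psi = (psi`_0)%:P by apply: size1_polyC.
rewrite ep evC in evpsi; rewrite evpsi in ez.
(* If the constant is zero, [z] has order at least [a] at [Q]; otherwise it has order 1. Its actual
   order [a - r] is strictly between. *)
have [c0|c0] := eqVneq psi`_0 0.
  have : vge Q a%:Z z by rewrite ez c0 rmorph0 mul0r add0r.
  by rewrite vge_neq0 // oz; clear - r_gt0; lia.
have cy0 : cst psi`_0 * y != 0 by rewrite mulf_neq0 ?fmorph_eq0.
have ocy : ord Q (cst psi`_0 * y) = 1.
  by rewrite (cv_ordM V) ?fmorph_eq0 // (cv_ord_cst V) // oy.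
have [|_] := ordD_lt V (R := Q) (g := x * F) cy0.
  by rewrite ocy; apply: vgeW Qxf; clear - a_gt2; lia.
by rewrite -ez oz ocy; clear - ra; lia.
Qed.

End Coordinates.

Theorem no_two_places (k r : nat) (x y u v : L) :
  b = (k * a + r)%N -> (0 < r)%N -> (r + 2 <= a)%N -> Q != P ->
  x != 0 -> A x -> ord P x = - a%:Z -> y != 0 -> A y -> ord P y = - b%:Z ->
  u != 0 -> regular_off ord Q u -> ord Q u = - a%:Z ->
  v != 0 -> regular_off ord Q v -> ord Q v = - b%:Z -> False.
Proof.
move=> eb r_gt0 ra QP x0 Ax ox y0 Ay oy u0 Qu ou v0 Qv ov.
(* Subtracting the value at [Q] creates a zero there and leaves the pole at [P] unchanged. *)
have normalize (z : L) (n : nat) : (0 < n)%N -> z != 0 -> A z -> ord P z = - n%:Z ->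
    exists z', [/\ z' != 0, A z', ord P z' = - n%:Z & vge Q 1 z'].
  move=> n0 z0 Az oz; have [c vc] := cv_residue V (Az Q QP).
  have [z'0 oz'] : z - cst c != 0 /\ ord P (z - cst c) = ord P z.
    apply: (ordD_lt V) => //; apply: (vgeN V).
    by apply: vgeW (vge_cst V P c); lia.
  exists (z - cst c); split; rewrite ?oz' //.
  by apply: (regB V) => //; exact: (reg_cst V).
have a0 : (0 < a)%N by clear - a_gt2; lia.
have b0 : (0 < b)%N by clear - lt_ab; lia.
have [x' [x'0 Ax' ox' Qx']] := normalize x a a0 x0 Ax ox.
have [y' [y'0 Ay' oy' Qy']] := normalize y b b0 y0 Ay oy.
exact: (coordinates_contra x'0 y'0 Ax' Ay' ox' oy' QP Qx' Qy' u0 Qu ou v0 Qv ov eb).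
Qed.

End TwoPoints.

(** * Orders from local rings *)

Section LocalRings.

Variables (K L : fieldType) (cst : {rmorphism K -> L}) (pt : eqType).
Variable O : pt -> set L.

(** This and the next two definitions abstract [local_unit], [uniformizer] and [ord] from the curve;
    at [O := local_ring] they agree by conversion. *)
Definition unit_at (P : pt) (u : L) : Prop := [/\ u != 0, O P u & O P u^-1].

Definition unif_at (P : pt) (t : L) : Prop :=
  [/\ t != 0, O P t, ~ unit_at P t &
     forall f, O P f -> f != 0 ->
       exists (m : nat) (u : L), unit_at P u /\ f = u * t ^+ m].

Definition ord_at (P : pt) (f : L) : int :=
  xget 0 [set m | exists t u, [/\ unif_at P t, unit_at P u & f = u * t ^ m]].

Hypothesis localC : forall P c, O P (cst c).
Hypothesis localB : forall P f g, O P f -> O P g -> O P (f - g).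
Hypothesis localM : forall P f g, O P f -> O P g -> O P (f * g).
Hypothesis O_residue : forall P f, O P f ->
  exists c, O P (f - cst c) /\ ~ unit_at P (f - cst c).
Hypothesis O_fraction : forall P f,
  exists f1 f2, [/\ O P f1, O P f2, f2 != 0 & f * f2 = f1].

Lemma local0 P : O P (0 : L).
Proof. by rewrite -(rmorph0 cst); exact: localC. Qed.

Lemma local1 P : O P (1 : L).
Proof. by rewrite -(rmorph1 cst); exact: localC. Qed.

Lemma localD P (f g : L) : O P f -> O P g -> O P (f + g).
Proof.
move=> lf lg; rewrite -[g]opprK; apply: localB => //.
by rewrite -sub0r; apply: localB => //; exact: local0.
Qed.

Lemma localX P (f : L) m : O P f -> O P (f ^+ m).
Proof.
by move=> lf; elim: m => [|m IH]; [exact: local1|rewrite exprS; exact: localM].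
Qed.

Lemma unit_at1 P : unit_at P (1 : L).
Proof. by split; rewrite ?oner_neq0 ?invr1 //; exact: local1. Qed.

Lemma unit_atM P (f g : L) :
  unit_at P f -> unit_at P g -> unit_at P (f * g).
Proof.
move=> [f0 lf lf'] [g0 lg lg']; split; first by rewrite mulf_neq0.
  exact: localM.
by rewrite invfM; exact: localM.
Qed.

Lemma unit_atV P (f : L) : unit_at P f -> unit_at P f^-1.
Proof. by move=> [f0 lf lf']; split; rewrite ?invr_eq0 ?invrK. Qed.

Lemma unit_atXz P (f : L) (m : int) : unit_at P f -> unit_at P (f ^ m).
Proof.
move=> uf; have pos (k : nat) : unit_at P (f ^+ k).
  elim: k => [|k IH]; first exact: unit_at1.
  by rewrite exprS; exact: unit_atM.
by case: m => k; [exact: pos|apply/unit_atV/pos].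
Qed.

Lemma unif_at_decomp P (t f : L) : unif_at P t -> f != 0 ->
  exists (m : int) u, unit_at P u /\ f = u * t ^ m.
Proof.
move=> [t0 _ _ dec] f0; have [f1 [f2 [l1 l2 f20 e]]] := O_fraction P f.
have f10 : f1 != 0 by rewrite -e mulf_neq0.
have [m1 [u1 [lu1 e1]]] := dec _ l1 f10; have [m2 [u2 [lu2 e2]]] := dec _ l2 f20.
exists (m1%:Z - m2%:Z), (u1 * u2^-1); split.
  exact/unit_atM/unit_atV.
have [u20 _ _] := lu2; have tm : t ^+ m2 != 0 by rewrite expf_neq0.
apply: (mulIf f20); rewrite e e1 e2 expfzDr // -exprnN -exprnP.
by move: (t ^+ m1) (t ^+ m2) tm => A B B0; field; rewrite u20 B0.
Qed.

(** If a positive power of [t] were a unit, then [t^-1] would be regular, as a power of [t] times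
    the inverse of that unit. *)
Lemma unif_at_unitX P (t : L) (m : int) : unif_at P t ->
  unit_at P (t ^ m) -> m = 0.
Proof.
move=> [t0 lt nut _]; have pos (k : nat) : ~ unit_at P (t ^+ k.+1).
  move=> [_ _ lV]; apply: nut; split=> //.
  have -> : t^-1 = t ^+ k * (t ^+ k.+1)^-1.
    by rewrite exprSr invfM mulrA mulfV ?mul1r ?expf_neq0.
  exact/localM/lV/localX.
case: m => [[|k]|k] // um; first by case: (pos k).
by have := unit_atV um; rewrite NegzE -exprnN invrK => /pos.
Qed.

(** Each of [t], [t'] is a unit times a power of the other; composing makes [t ^ (m * m' - 1)] a
    unit, so both exponents are 1. *)
Lemma unif_at_assoc P (t t' : L) : unif_at P t -> unif_at P t' ->
  exists2 w, unit_at P w & t' = w * t.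
Proof.
move=> ut ut'; have [t0 lt nut dec] := ut; have [t'0 lt' nut' dec'] := ut'.
have [m [w [uw e]]] := dec _ lt' t'0; have [m' [w' [uw' e']]] := dec' _ lt t0.
have : unit_at P (t ^ ((m * m')%N%:Z - 1)).
  have [w0 _ _] := uw; have [w'0 _ _] := uw'.
  have W0 : w' * w ^+ m' != 0 by rewrite mulf_neq0 ?expf_neq0.
  have e2 : t = w' * w ^+ m' * t ^+ (m * m').
    by rewrite {1}e' e exprMn -exprM mulrA.
  have -> : t ^ ((m * m')%N%:Z - 1) = (w' * w ^+ m')^-1.
    apply: (mulfI W0); rewrite expfzDr // -exprnN expr1 -exprnP.
    by rewrite mulrA -e2 !divff.
  exact/unit_atV/unit_atM/(unit_atXz m').
move=> /(unif_at_unitX ut) /eqP; rewrite subr_eq0 => /eqP[] mm.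
have m1 : m = 1%N by move: mm; case: m {e} => [|[|m]] //; case: m' {e'} => [|[]] //; lia.
by exists w => //; rewrite e m1 expr1.
Qed.

Hypothesis smooth : forall P : pt, exists t, unif_at P t.

(** The exponent chosen by [xget] is independent of the uniformizer and of the unit. *)
Lemma ord_at_eq P (t u f : L) (m : int) : unif_at P t -> unit_at P u ->
  f = u * t ^ m -> ord_at P f = m.
Proof.
move=> ut uu e; rewrite /ord_at; case: xgetP => [m' _ /= [t' [u' [ut' uu' e']]]|no].
  have [w uw et'] := unif_at_assoc ut ut'.
  have [t0 _ _ _] := ut; have [w0 _ _] := uw.
  have [u0 _ _] := uu; have [u'0 _ _] := uu'.
  suff /(unif_at_unitX ut) : unit_at P (t ^ (m' - m)).
    by move/eqP; rewrite subr_eq0 => /eqP.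
  have -> : t ^ (m' - m) = u * (u' * w ^ m')^-1.
    have W0 : u' * w ^ m' != 0 by rewrite mulf_neq0 ?expfz_neq0.
    apply/eqP; rewrite expfzDr // -invr_expz eqr_div ?expfz_neq0 //.
    by rewrite -e e' et' expfzMl mulrC mulrA.
  by apply: unit_atM => //; apply/unit_atV/unit_atM/unit_atXz.
by case: (no m); exists t, u.
Qed.

Lemma ord_at_spec P : exists t : L, [/\ unif_at P t, t != 0 &
  forall f, f != 0 -> exists2 u, unit_at P u & f = u * t ^ ord_at P f].
Proof.
have [t ut] := smooth P; have [t0 _ _ _] := ut; exists t; split=> // f f0.
by have [m [u [uu e]]] := unif_at_decomp ut f0; exists u; rewrite ?(ord_at_eq ut uu e).
Qed.

Lemma O_vge P (f : L) : O P f <-> vge ord_at P 0 f.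
Proof.
have [->|f0] := eqVneq f 0; first by rewrite vge0; split=> // _; exact: local0.
rewrite vge_neq0 //; have [t [ut t0 spec]] := ord_at_spec P.
have [u uu e] := spec _ f0; split=> [lf|o0].
  have [_ _ _ dec] := ut; have [m [w [uw ew]]] := dec _ lf f0.
  by rewrite (ord_at_eq ut uw (m := m)).
rewrite e; apply: localM; first by case: uu.
by case: (ord_at P f) o0 => // m _; case: ut => _ lt _ _; exact: localX.
Qed.

Lemma ord_atM P (f g : L) : f != 0 -> g != 0 ->
  ord_at P (f * g) = ord_at P f + ord_at P g.
Proof.
have [t [ut t0 spec]] := ord_at_spec P.
move=> f0 g0; have [u uu e] := spec _ f0; have [w uw e'] := spec _ g0.
apply: (ord_at_eq ut (unit_atM uu uw)).
by rewrite {1}e {1}e' expfzDr // mulrACA.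
Qed.

Lemma ord_at_vgeD P m (f g : L) : vge ord_at P m f ->
  vge ord_at P m g -> vge ord_at P m (f + g).
Proof.
have [t [ut t0 spec]] := ord_at_spec P.
have tm0 k : t ^ k != 0 by rewrite expfz_neq0.
have otm k : ord_at P (t ^ k) = k.
  by apply: (ord_at_eq ut (unit_at1 P)); rewrite mul1r.
(* Dividing by [t ^ m] reduces the claim to closure of [O P] under addition. *)
have shift (h : L) : vge ord_at P m h <-> O P (h * t ^ (- m)).
  rewrite O_vge; have [->|h0] := eqVneq h 0.
    by rewrite mul0r !vge0.
  by rewrite !vge_neq0 ?mulf_neq0 // ord_atM // otm subr_ge0.
by rewrite !shift mulrDl; exact: localD.
Qed.

Lemma unit_at_ord P (f : L) : unit_at P f -> ord_at P f = 0.
Proof.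
have [t [ut _ _]] := ord_at_spec P => uf.
by apply: (ord_at_eq ut uf); rewrite mulr1.
Qed.

Lemma nonunit_vge P (f : L) : O P f -> ~ unit_at P f -> vge ord_at P 1 f.
Proof.
move=> /O_vge lf nuf; move: lf; have [->|f0] := eqVneq f 0; first by rewrite !vge0.
rewrite !vge_neq0 // le_eqVlt => /orP[/eqP o0|]; last by [].
have [t [ut _ spec]] := ord_at_spec P; have [u uu e] := spec _ f0.
by case: nuf; rewrite e -o0 mulr1.
Qed.

Lemma ord_at_valuations : curve_valuations cst ord_at.
Proof.
split; first exact: ord_atM.
- exact: ord_at_vgeD.
- move=> P c c0; have [t [ut _ _]] := ord_at_spec P.
  apply: (ord_at_eq ut (u := cst c)); last by rewrite mulr1.
  by split; rewrite ?fmorph_eq0 -?fmorphV //; exact: localC.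
- by move=> P f /O_vge /O_residue[c [lc nuc]]; exists c; exact: nonunit_vge.
move=> P; have [t [ut t0 _]] := ord_at_spec P; exists t => //.
by apply: (ord_at_eq ut (unit_at1 P)); rewrite mul1r expr1z.
Qed.

End LocalRings.

(** * Values of a function at the zeros of another *)

Section AlgebraicRelation.

Variables (K L : fieldType) (cst : {rmorphism K -> L}) (pt : eqType).
Variable ord : pt -> L -> int.
Hypothesis V : curve_valuations cst ord.

Local Notation "phi <[ y ]>" := ((map_poly cst phi).[y]) (at level 2).

Lemma mmap1_ord2 (g : 'I_2 -> L) (m : 'X_{1..2}) :
  mmap1 g m = g 0 ^+ m 0%R * g 1 ^+ m 1%R.
Proof.
rewrite /mmap1 !big_ord_recl big_ord0 mulr1.
have -> : ord0 = 0%R :> 'I_2 by exact: val_inj.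
by have -> : fintype.lift 0%R ord0 = 1%R :> 'I_2 by exact: val_inj.
Qed.

(** Modulo functions vanishing at [R], the value of [phi] at [z] is the constant [phi.[c]]. *)
Lemma ev_residue R (phi : {poly K}) (z : L) c : vge ord R 0 z ->
  vge ord R 1 (z - cst c) -> vge ord R 1 phi<[z]> -> root phi c.
Proof.
move=> z0 zc; have /factor_theorem[psi epsi] : root (phi - (phi.[c])%:P) c.
  by rewrite /root hornerD hornerN hornerC subrr.
have -> : phi<[z]> = psi<[z]> * (z - cst c) + cst phi.[c].
  rewrite -[in LHS](subrK (phi.[c])%:P phi) epsi evD evC rmorphM /= hornerM.
  by rewrite map_polyXsubC hornerXsubC.
move=> v1; have v2 : vge ord R 1 (psi<[z]> * (z - cst c)).
  by rewrite -[1]add0r (vgeM V) // (vge_ev V).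
apply: contraTT v1 => c0; apply/negP => v1; have := vgeB V v1 v2.
by rewrite addrC addKr vge_neq0 ?fmorph_eq0 // (cv_ord_cst V).
Qed.

(* After division by the largest power of f, the relation p(f, z) = 0 becomes
   q(z) + f h = 0, so q vanishes at the value of z wherever f vanishes. *)
Lemma algebraic_values (p : {mpoly K[2]}) (g : 'I_2 -> L) :
  g 0 != 0 -> p != 0 -> mmap cst g p = 0 ->
  exists2 q : {poly K}, q != 0 & forall R c, vge ord R 1 (g 0) ->
    vge ord R 0 (g 1) -> vge ord R 1 (g 1 - cst c) -> root q c.
Proof.
move=> f0 p0 rel.
have [m0 [m0p m0min]] : exists m0 : 'X_{1..2}, m0 \in msupp p /\
    forall m : 'X_{1..2}, m \in msupp p -> (m0 0%R <= m 0%R)%N.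
  have ne : exists k, has (fun m : 'X_{1..2} => m 0%R == k) (msupp p).
    exists (mlead p 0%R); apply/hasP; exists (mlead p) => //; exact: mlead_supp.
  case: (ex_minnP ne) => k /hasP[m0 m0p /eqP <-] kmin.
  by exists m0; split=> // m mp; apply: kmin; apply/hasP; exists m.
set k := m0 0%R in m0min.
pose q : {poly K} := \sum_(m <- msupp p | m 0%R == k) p@_m *: 'X^(m 1%R).
pose h : L := \sum_(m <- msupp p | m 0%R != k)
  cst p@_m * (g 0 ^+ (m 0%R - k.+1) * g 1 ^+ m 1%R).
have qh : q<[g 1]> + g 0 * h = 0.
  apply: (mulfI (expf_neq0 k f0)); rewrite mulr0 -rel /mmap.
  rewrite (bigID (fun m : 'X_{1..2} => m 0%R == k)) /= mulrDr; congr (_ + _).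
    rewrite raddf_sum horner_sum mulr_sumr; apply: eq_bigr => m /eqP <-.
    by rewrite evZXn mulrCA mmap1_ord2.
  rewrite /h !mulr_sumr big_seq_cond [RHS]big_seq_cond.
  apply: eq_bigr => m /andP[mp mk]; rewrite mmap1_ord2.
  have -> : g 0 ^+ m 0%R = g 0 ^+ k * (g 0 * g 0 ^+ (m 0%R - k.+1)).
    have := m0min _ mp; rewrite leq_eqVlt eq_sym (negPf mk) /= => km.
    by rewrite -exprS -exprD; congr (_ ^+ _); lia.
  by ring.
exists q.
  (* Among the monomials with minimal exponent of [g 0], only [m0] contributes to this
     coefficient. *)
  apply/eqP => /(congr1 (fun r : {poly K} => r`_(m0 1%R))); rewrite coef0 coef_sum.
  rewrite -big_filter (bigD1_seq m0) ?filter_uniq ?msupp_uniq //=; last first.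
    by rewrite mem_filter eqxx.
  rewrite coefZ coefXn eqxx mulr1 big1_seq ?addr0 => [/eqP|m].
    by rewrite -[_ == 0]negbK -mcoeff_msupp m0p.
  rewrite mem_filter => /andP[mm0 /andP[/eqP mk _]].
  rewrite coefZ coefXn; case: eqP => [e|_]; last by rewrite mulr0.
  case/negP: mm0; apply/eqP/mnmP => i; case: i => -[|[|//]] i.
    by rewrite -[Ordinal i](_ : 0%R = _) ?mk //; exact: val_inj.
  by rewrite -[Ordinal i](_ : 1%R = _) ?e //; exact: val_inj.
move=> R c fR zR zc; apply: (ev_residue zR zc).
have -> : q<[g 1]> = - (g 0 * h) by apply/eqP; rewrite -addr_eq0 qh.
apply: (vgeN V); rewrite -[1]addr0; apply: (vgeM V) => //.
rewrite /h; elim/big_rec: _ => [|m x _ vx]; first exact: vge0.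
apply: (cv_vgeD V) => //; apply: (vgeZ V).
have v0 : vge ord R 0 (g 0) by apply: vgeW fR.
have vX (l : nat) (w : L) : vge ord R 0 w -> vge ord R 0 (w ^+ l).
  by move=> vw; rewrite -(mul0r l%:Z); apply: (vgeX V).
apply: (@vgeM _ _ _ _ _ V R 0 0); exact: vX.
Qed.

End AlgebraicRelation.

(** * Projective curves *)

Section Curve.

Variables (K : closedFieldType) (n : nat) (X : projective_variety K n).

Local Notation L := (function_field X).
Local Notation I := (ideal_of X).
Local Notation form := {mpoly K[n.+1]}.

Lemma form_ratio_eq (F G F' G' : form) : G \notin I -> G' \notin I ->
  (form_ratio X F G == form_ratio X F' G') = (F * G' - F' * G \in I).
Proof.
move=> GI GI'; rewrite /form_ratio /ratio_of.
rewrite eqr_div ?tofrac_eq0 ?to_coord_eq0 // -!rmorphM tofrac_eq.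
by rewrite -subr_eq0 -rmorphB to_coord_eq0.
Qed.

Lemma form_ratio1 (F : form) : form_ratio X F 1 = tofrac (to_coord X F).
Proof. by rewrite /form_ratio /ratio_of !rmorph1 divr1. Qed.

Lemma ff_valB (f g : L) : val (f - g) = val f - val g.
Proof. exact: (rmorphB (val : subfield _ -> _)). Qed.

Lemma ff_valM (f g : L) : val (f * g) = val f * val g.
Proof. exact: (rmorphM (val : subfield _ -> _)). Qed.

Lemma ff_val0 : val (0 : L) = 0.
Proof. exact: (rmorph0 (val : subfield _ -> _)). Qed.

Lemma ff_val1 : val (1 : L) = 1.
Proof. exact: (rmorph1 (val : subfield _ -> _)). Qed.

Lemma ff_inj (f g : L) : val f = val g -> f = g.
Proof. exact: val_inj. Qed.

Lemma val_const c : val (const X c) = tofrac (to_coord X c%:MP).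
Proof. exact: form_ratio1. Qed.

Lemma const_is_zmod_morphism : zmod_morphism (@const K n X).
Proof.
move=> c d; apply: ff_inj. rewrite [RHS]ff_valB !val_const mpolyCB.
by rewrite (rmorphB (to_coord X)) (rmorphB (@tofrac _)).
Qed.

HB.instance Definition _ := GRing.isZmodMorphism.Build K L (@const K n X)
  const_is_zmod_morphism.

Lemma const_is_monoid_morphism : monoid_morphism (@const K n X).
Proof.
split=> [|c d]; apply: ff_inj.
  by rewrite ff_val1 val_const (rmorph1 (to_coord X)) (rmorph1 (@tofrac _)).
rewrite [RHS]ff_valM !val_const mpolyCM.
by rewrite (rmorphM (to_coord X)) (rmorphM (@tofrac _)).
Qed.

HB.instance Definition _ := GRing.isMonoidMorphism.Build K L (@const K n X)
  const_is_monoid_morphism.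

(** The value depends on the chosen representative vector, but vanishing of a form and ratios of
    forms of equal degree do not. *)
Definition eval_at (P : point X) (F : form) : K :=
  F.@[vpick (val (val P)) ord0].

Lemma eval_at_ideal P F : F \in I -> eval_at P F = 0.
Proof.
move=> /ideal_ofP FI; apply: FI; [exact/set_mem/(valP P)|exact: memv_pick|].
by rewrite vpick0 -dimv_eq0 (eqP (valP (val P))).
Qed.

Lemma dhomog_mevalZ d (F : form) (c : K) (w : 'I_n.+1 -> K) : F \is d.-homog ->
  F.@[fun i => c * w i] = c ^+ d * F.@[w].
Proof.
move=> /dhomogP hF; rewrite !mevalE mulr_sumr; apply: eq_big_seq => m /hF <-.
rewrite mulrCA; congr (_ * _); rewrite /= mdegE -prodrXr -big_split /=.
by apply: eq_bigr => i _; rewrite exprMn.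
Qed.

Lemma vline_point (P : pspace K n) : val P = <[vpick (val P)]>%VS.
Proof.
apply/esym/eqP; rewrite eqEdim (eqP (valP P)) dim_vline vpick0 -dimv_eq0.
by rewrite (eqP (valP P)) -memvE memv_pick.
Qed.

Lemma zero_at_eval d (P : point X) (F : form) : F \is d.-homog ->
  zero_at (val P) F <-> eval_at P F = 0.
Proof.
move=> hF; split=> [|F0 w wP _].
  by apply; [exact: memv_pick|rewrite vpick0 -dimv_eq0 (eqP (valP (val P)))].
move: wP; rewrite vline_point => /vlineP[c ->].
rewrite -(mulr0 (c ^+ d)) -F0 -(dhomog_mevalZ _ _ hF).
by apply: meval_eq => i; rewrite mxE.
Qed.

Lemma not_zero_atE d (P : point X) (F : form) : F \is d.-homog ->
  ~ zero_at (val P) F -> eval_at P F != 0.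
Proof. by move=> hF /(zero_at_eval P hF)/eqP. Qed.

Lemma eval_at_notin P F : eval_at P F != 0 -> F \notin I.
Proof. by apply: contra => /(eval_at_ideal P)->. Qed.

Lemma local_ringP P (f : L) : local_ring P f <->
  exists d F G, [/\ F \is d.-homog, G \is d.-homog, eval_at P G != 0 &
                    val f = form_ratio X F G].
Proof.
split=> -[d [F [G [hF hG G0 ef]]]]; exists d, F, G; split=> //.
  exact: not_zero_atE hG G0.
by rewrite (zero_at_eval P hG); apply/eqP.
Qed.

Lemma local_const P c : local_ring P (const X c).
Proof.
apply/local_ringP; exists 0%N, c%:MP, 1; split; rewrite ?dhomog1 //.
  by rewrite -[c%:MP]mulr1 mul_mpolyC; apply/dhomogZ/dhomog1.
by rewrite /eval_at meval1 oner_neq0.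
Qed.

Lemma localB P (f g : L) : local_ring P f -> local_ring P g -> local_ring P (f - g).
Proof.
move=> /local_ringP[d [F [G [hF hG G0 ef]]]] /local_ringP[e [F' [G' [hF' hG' G0' eg]]]].
apply/local_ringP; exists (d + e)%N, (F * G' - F' * G), (G * G'); split.
- by apply: rpredB; [|rewrite addnC]; exact: dhomogM.
- exact: dhomogM.
- by rewrite /eval_at mevalM mulf_neq0.
rewrite ff_valB ef eg; apply: ratio_ofB; rewrite to_coord_eq0.
  exact: eval_at_notin G0.
exact: eval_at_notin G0'.
Qed.

Lemma localM P (f g : L) : local_ring P f -> local_ring P g -> local_ring P (f * g).
Proof.
move=> /local_ringP[d [F [G [hF hG G0 ef]]]] /local_ringP[e [F' [G' [hF' hG' G0' eg]]]].
apply/local_ringP; exists (d + e)%N, (F * F'), (G * G'); split.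
- exact: dhomogM.
- exact: dhomogM.
- by rewrite /eval_at mevalM mulf_neq0.
by rewrite ff_valM ef eg; apply: ratio_ofM.
Qed.

(** The numerator [F - c G] vanishes at [P]. Were the inverse a regular quotient [F' / G'],
    evaluating the cross-multiplied identity at [P] would make [G] or [G'] vanish there. *)
Lemma local_ratio_residue P d (F G : form) (f : L) :
  F \is d.-homog -> G \is d.-homog -> eval_at P G != 0 ->
  val f = form_ratio X F G ->
  let c := eval_at P F / eval_at P G in
  local_ring P (f - const X c) /\ ~ local_unit P (f - const X c).
Proof.
move=> hF hG G0 ef c; split.
  by apply: localB; [apply/local_ringP; exists d, F, G|exact: local_const].
have GI := eval_at_notin G0.
have e1 : val (f - const X c) = form_ratio X (F - c%:MP * G) G.
  rewrite ff_valB ef val_const /form_ratio /ratio_of.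
  rewrite !rmorphB !rmorphM mulrBl mulfK //.
  by rewrite tofrac_eq0 to_coord_eq0.
move=> [fc0 _ /local_ringP[e [F' [G' [hF' hG' G0' eV]]]]].
have GI' := eval_at_notin G0'.
have : form_ratio X ((F - c%:MP * G) * F') (G * G') == form_ratio X 1 1.
  rewrite -[form_ratio X (_ * _) _]ratio_ofM -/(form_ratio _ _ _).
  rewrite -/(form_ratio _ _ _) -e1 -eV -ff_valM mulfV //=.
  by rewrite form_ratio1 !rmorph1.
rewrite form_ratio_eq ?ideal_ofM ?idealr1 // => /(eval_at_ideal P)/eqP.
rewrite /eval_at !(mevalB, mevalM, meval1) mevalC.
rewrite -!/(eval_at _ _) divfK // subrr !mul0r sub0r mul1r oppr_eq0.
by rewrite mulf_eq0 (negPf G0) (negPf G0').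
Qed.

Lemma local_residue P (f : L) : local_ring P f ->
  exists c, local_ring P (f - const X c) /\ ~ local_unit P (f - const X c).
Proof.
move=> /local_ringP[d [F [G [hF hG G0 ef]]]].
by exists (eval_at P F / eval_at P G); exact: (local_ratio_residue hF hG G0 ef).
Qed.

Lemma ff_forms d (F G : form) : F \is d.-homog -> G \is d.-homog -> G \notin I ->
  exists f : L, val f = form_ratio X F G.
Proof.
move=> hF hG GI; have rf : form_ratio X F G \in is_ratfun (X := X).
  by apply/is_ratfunP; exists d, F, G.
by exists (SubField (S := GRing.DivringClosed.clone _ _ _) rf).
Qed.

Lemma form_ratio_trans (F G H : form) : G \notin I ->
  form_ratio X F G * form_ratio X G H = form_ratio X F H.
Proof.
rewrite -to_coord_eq0 -tofrac_eq0 /form_ratio /ratio_of.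
move: (tofrac _) (tofrac _) (tofrac _) => A B C C0.
by rewrite mulrA divfK.
Qed.

Lemma eval_coord_neq0 P : exists i : 'I_n.+1, eval_at P 'X_i != 0.
Proof.
apply/not_existsP => no; have /negP[] : vpick (val (val P)) != 0.
  by rewrite vpick0 -dimv_eq0 (eqP (valP (val P))).
apply/eqP/rowP => i; rewrite mxE; apply/eqP/negPn/negP => vi.
by apply: (no i); rewrite /eval_at mevalXU.
Qed.

Lemma dhomog_coordX (i : 'I_n.+1) d : ('X_i ^+ d : form) \is d.-homog.
Proof. by rewrite -[X in X.-homog]mul1n; apply: dhomogMn; rewrite dhomogX /= mdeg1. Qed.

Lemma ff_neq0 (F G : form) (f : L) : F \notin I -> G \notin I ->
  val f = form_ratio X F G -> f != 0.
Proof.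
rewrite -!to_coord_eq0 -(tofrac_eq0 (to_coord X F))
        -(tofrac_eq0 (to_coord X G)) => F0 G0 ef; apply/eqP => f0.
have : val f == 0 by rewrite f0 ff_val0.
by rewrite ef mulf_eq0 invr_eq0 (negPf F0) (negPf G0).
Qed.

(** Divide numerator and denominator by the power of a coordinate not vanishing at [P]. *)
Lemma local_fraction P (f : L) :
  exists f1 f2, [/\ local_ring P f1, local_ring P f2, f2 != 0 & f * f2 = f1].
Proof.
have /is_ratfunP[d [F [G [hF hG GI ef]]]] := valP f.
have [i i0] := eval_coord_neq0 P; have hX := dhomog_coordX i d.
have X0 : eval_at P ('X_i ^+ d) != 0.
  by rewrite /eval_at rmorphXn expf_neq0.
have XI := eval_at_notin X0.
have [f1 e1] := ff_forms hF hX XI; have [f2 e2] := ff_forms hG hX XI.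
exists f1, f2; split.
- by apply/local_ringP; exists d, F, ('X_i ^+ d).
- by apply/local_ringP; exists d, G, ('X_i ^+ d).
- exact: ff_neq0 GI XI e2.
by apply: ff_inj; rewrite [LHS]ff_valM ef e1 e2; exact: form_ratio_trans.
Qed.

Hypothesis smooth : forall P : point X, smooth_at P.

Lemma ord_valuations : curve_valuations (@const K n X) (@ord K n X).
Proof.
apply: (@ord_at_valuations K L _ (point X) (@local_ring K n X)).
- exact: local_const.
- exact: localB.
- exact: localM.
- exact: local_residue.
- exact: local_fraction.
exact: smooth.
Qed.

Lemma nonunit_ord P (f : L) : local_ring P f -> ~ local_unit P f ->
  vge (@ord K n X) P 1 f.
Proof.
exact: (nonunit_vge (@local_const) localM local_fraction smooth).
Qed.

Lemma local_vge P (f : L) : local_ring P f -> vge (@ord K n X) P 0 f.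
Proof.
by move=> lf; apply/(O_vge (@local_const) localM local_fraction smooth).
Qed.

Lemma ord_unit P (f : L) : local_unit P f -> ord P f = 0.
Proof.
exact: (unit_at_ord (@local_const) localM local_fraction smooth).
Qed.

(** * Finiteness of zeros and poles *)

Hypothesis dim1 : ~ exists f : 'I_2 -> L, alg_independent f.

Lemma roots_seq (q : {poly K}) : q != 0 ->
  exists s : seq K, forall c, root q c -> c \in s.
Proof.
move=> q0; have [s es] := closed_field_poly_normal q; exists s => c.
by rewrite es rootZ ?lead_coef_eq0 // root_prod_XsubC.
Qed.

(** In dimension 1, each affine coordinate satisfies a nontrivial relation with [F / X_i ^ d], so it
    takes finitely many values on the zeros of [F]. *)
Lemma chart_finite i d (F : form) : F \is d.-homog -> F \notin I ->
  exists s : seq (point X), forall P,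
    eval_at P F = 0 -> eval_at P 'X_i != 0 -> P \in s.
Proof.
move=> hF FI; have [XI|XI] := boolP (('X_i : form) \in I).
  by exists [::] => P _; rewrite (eval_at_ideal P XI) eqxx.
have hX j : ('X_j : form) \is 1.-homog by rewrite -['X_j]expr1 dhomog_coordX.
have XdI : ('X_i ^+ d : form) \notin I.
  elim: d {hF} => [|d IH]; first by rewrite expr0 idealr1.
  by rewrite exprS ideal_ofM.
have [phi ephi] := ff_forms hF (dhomog_coordX i d) XdI.
have phi0 : phi != 0 := ff_neq0 FI XdI ephi.
have val1 P e (G H : form) (f : L) : G \is e.-homog -> H \is e.-homog ->
    eval_at P H != 0 -> val f = form_ratio X G H ->
    vge (@ord K n X) P 1 (f - const X (eval_at P G / eval_at P H)).
  move=> hG hH H0 ef; have [lf nuf] := local_ratio_residue hG hH H0 ef.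
  exact: nonunit_ord.
have coord j : exists s : seq K, forall P, eval_at P F = 0 ->
    eval_at P 'X_i != 0 -> eval_at P 'X_j / eval_at P 'X_i \in s.
  have [z ez] := ff_forms (hX j) (hX i) XI.
  pose g (k : 'I_2) := if k == 0 then phi else z.
  have /existsNP[p /not_implyP[rel /eqP p0]] : ~ alg_independent g.
    by move=> ag; apply: dim1; exists g.
  have [q q0 qr] := algebraic_values (ord_valuations) (g := g) phi0 p0 rel.
  have [s sP] := roots_seq q0; exists s => P F0 Xi0; apply/sP/(qr P).
  - have Xd0 : eval_at P ('X_i ^+ d) != 0 by rewrite /eval_at rmorphXn expf_neq0.
    have := val1 P _ _ _ _ hF (dhomog_coordX i d) Xd0 ephi.
    by rewrite F0 mul0r rmorph0 subr0.
  - by apply/local_vge/local_ringP; exists 1%N, 'X_j, 'X_i.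
  - exact: val1 (hX j) (hX i) Xi0 ez.
have [s sP] := choice coord.
pose S := flatten [seq s j | j <- enum 'I_n.+1].
(* Candidates are the spans of all tuples of possible values; the two [pmap insub] keep those of
   dimension 1 that lie on [X]. *)
pose lines := [seq <[\row_j val (g j : seq_sub S)]>%VS | g : {ffun 'I_n.+1 -> seq_sub S}].
exists (pmap insub (pmap insub lines)) => P F0 Xi0.
rewrite mem_pmap_sub mem_pmap_sub.
have cS j : eval_at P 'X_j / eval_at P 'X_i \in S.
  by apply/flatten_mapP; exists j; rewrite ?mem_enum //; exact: sP.
apply/mapP; exists [ffun j => SeqSub (cS j)]; first by rewrite mem_enum.
rewrite [LHS]vline_point; set v := vpick _.
have -> : \row_j val ([ffun j => SeqSub (cS j)] j) = (eval_at P 'X_i)^-1 *: v.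
  by apply/rowP => j; rewrite !mxE ffunE /= /eval_at !mevalXU mulrC.
apply/eqP; rewrite eq_sym eqEdim !dim_vline scaler_eq0 invr_eq0 (negPf Xi0) leqnn.
by rewrite andbT -memvE memvZ ?memv_line.
Qed.

Lemma form_zeros_finite d (F : form) : F \is d.-homog -> F \notin I ->
  exists s : seq (point X), forall P, eval_at P F = 0 -> P \in s.
Proof.
move=> hF FI; have [s sP] := choice (fun i => chart_finite i hF FI).
exists (flatten [seq s i | i <- enum 'I_n.+1]) => P F0.
have [i Xi] := eval_coord_neq0 P; apply/flatten_mapP; exists i.
  by rewrite mem_enum.
exact: sP.
Qed.

Lemma ord_finite (f : L) : f != 0 ->
  exists s : seq (point X), forall P, P \notin s -> ord P f = 0.
Proof.
move=> f0; have /is_ratfunP[d [F [G [hF hG GI ef]]]] := valP f.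
have FI : F \notin I.
  apply: contra f0; rewrite -to_coord_eq0 => /eqP F0; apply/eqP/ff_inj.
  have FG0 : form_ratio X F G = 0.
    by rewrite /form_ratio /ratio_of /= F0 rmorph0 mul0r.
  by rewrite ef FG0 ff_val0.
have [s sP] := form_zeros_finite hF FI; have [s' sP'] := form_zeros_finite hG GI.
exists (s ++ s') => P; rewrite mem_cat negb_or => /andP[Ps Ps'].
have F0 : eval_at P F != 0 by apply: contraNneq Ps => /sP.
have G0 : eval_at P G != 0 by apply: contraNneq Ps' => /sP'.
apply: ord_unit; split=> //; apply/local_ringP; first by exists d, F, G.
exists d, G, F; split=> //; rewrite -[RHS]ratio_ofV -/(form_ratio X F G) -ef.
exact: (fmorphV (val : subfield _ -> _)).
Qed.

Lemma divisor_of (h : point X -> int) (s : seq (point X)) :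
  (forall P, P \notin s -> h P = 0) ->
  exists D : divisor X, forall P, coeff P D = h P.
Proof.
move=> hs; exists (\sum_(P <- undup s) << h P *g P >>) => P.
rewrite raddf_sum /=; under eq_bigr do rewrite coeffU.
have [Ps|/[dup] Ps /hs->] := boolP (P \in s); last first.
  rewrite big1_seq // => Q /andP[_]; rewrite mem_undup => Qs.
  by case: eqP Ps => [<-|_]; rewrite ?Qs ?mulr0.
rewrite (bigD1_seq P) ?mem_undup ?undup_uniq //= eqxx mulr1 big1 ?addr0 // => Q QP.
by rewrite (negPf QP) mulr0.
Qed.

(** A member of the system avoiding [P] differs from [mP] by the divisor of a function with pole
    order exactly [m]. Conversely, [div f + mP] avoids [P], while [mP] avoids every other point. *)
Lemma weierstrass_setP P m : weierstrass_set P m <-> exists f : L,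
  [/\ f != 0, regular_off (@ord K n X) P f & ord P f = - m%:Z].
Proof.
have V := ord_valuations; split=> [[->|bpf]|[f [f0 rf of_]]].
- exists 1; split; rewrite ?oner_neq0 ?(ord1 V) //.
  by move=> R _; rewrite /vge (ord1 V) lexx orbT.
- have [E [effE [f f0 fE]] E0] := bpf P; exists f; split=> // [R RP|].
    rewrite vge_neq0 // fE coeffU eq_sym (negPf RP) mulr0 subr0; exact: effE.
  by rewrite fE E0 coeffU eqxx mulr1 sub0r.
right=> R; have [->|RP] := eqVneq R P.
  have [s sP] := ord_finite f0.
  have [|E hE] := @divisor_of (fun R => ord R f + m%:Z * (P == R)%:R) (P :: s).
    move=> Q; rewrite inE negb_or eq_sym => /andP[/negPf-> /sP->].
    by rewrite mulr0 addr0.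
  exists E; last by rewrite hE of_ eqxx mulr1 addNr.
  split.
    move=> Q; rewrite hE; have [<-|PQ] := eqVneq P Q.
      by rewrite of_ mulr1 addNr.
    by rewrite mulr0 addr0 -(vge_neq0 _ _ _ f0) rf // eq_sym.
  by exists f => // Q; rewrite hE coeffU addrK.
exists << m%:Z *g P >>; last by rewrite coeffU eq_sym (negPf RP) mulr0.
split.
  by move=> Q; rewrite coeffU mulr_ge0 // ler0n.
by exists 1; rewrite ?oner_neq0 // => Q; rewrite subrr (ord1 V).
Qed.

End Curve.

Local Close Scope classical_set_scope.

Theorem theoremA (R : realType) (a b : nat) (k r : int) :
  (0 < a)%N -> (0 < b)%N -> coprime a b -> (a + 2 <= b)%N ->
  b%:Z = k * a%:Z + r -> 1 <= r -> r <= a%:Z - 2 ->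
  let g := ((a - 1) * (b - 1) %/ 2)%N in
  weierstrass_semigroup (generated_semigroup a b) g /\
  occurs_at_most_once R[i] (generated_semigroup a b) g.
Proof.
move=> a0 b0 co ab eb r1 ra g; split; first exact: weierstrass_sgp.
have [r' er] : exists r' : nat, r = r'%:Z by exists `|r|%N; lia.
have [k' ek] : exists k' : nat, k = k'%:Z by exists `|k|%N; nia.
subst r k => -[n [C [P [Q [[[_ dim1] smooth] _ PQ]]]]].
rewrite generated_semigroupE // => WP WQ.
have ha : in_sgp a b a by apply/in_sgpP => //; exists 1%N, 0%N; lia.
have hb : in_sgp a b b by apply/in_sgpP => //; exists 0%N, 1%N; lia.
have pole S m : weierstrass_set S = [set n | in_sgp a b n]%classic -> in_sgp a b m ->
    exists f : function_field C,
      [/\ f != 0, regular_off (@ord _ n C) S f & ord S f = - m%:Z].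
  by move=> WS hm; apply/(weierstrass_setP smooth dim1); rewrite WS.
have [x [x0 Ax ox]] := pole P a WP ha; have [y [y0 Ay oy]] := pole P b WP hb.
have [u [u0 Au ou]] := pole Q a WQ ha; have [v [v0 Av ov]] := pole Q b WQ hb.
have QP : Q != P by rewrite eq_sym.
(* The range [1 <= r <= a - 2] is nonempty. *)
have a2 : (2 < a)%N by clear - r1 ra; lia.
have pole_sgp (f : function_field C) (m : nat) : f != 0 ->
    regular_off (@ord _ n C) P f -> ord P f = - m%:Z -> in_sgp a b m.
  move=> f0 Af of_; have : weierstrass_set P m.
    by apply/(weierstrass_setP smooth dim1); exists f.
  by rewrite WP.
apply: (no_two_places (ord_valuations smooth) (ord_finite smooth dim1) a2 ab co
  pole_sgp (k := k') (r := r') _ _ _ QP x0 Ax ox y0 Ay oy u0 Au ou v0 Av ov).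
- by clear - eb; lia.
- by clear - r1; lia.
- by clear - ra; lia.
Qed.
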